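(* Let $d\ge2$. Let $Z_0$ be the Crofton cell of the hypersphere tessellation derived from an isotropic Poisson point process $X$ on $\mathbb{S}^d$ with intensity $\gamma_s\in(0,\infty)$. Let $\Sigma$ be an increasing and rotation invariant size functional. If $a>0$ is such that $\Sigma^{-1}([a,\infty))\neq\emptyset$, then $$\lim_{\gamma_s\to\infty}\gamma_s^{-1}\ln\mathbb{P}\left(\Sigma(Z_0)\ge a\right)=-\tau(\Phi,\Sigma,a),$$ where $\Phi=2U_1$ and $\tau(\Phi,\Sigma,a)=\min\{\Phi(K):K\in\overline{\mathcal{K}}^d_s,\ \Sigma(K)\ge a\}$.
   Context: $\mathbb{S}^d$ is the unit sphere in $\mathbb{R}^{d+1}$ ($d\ge2$), $\sigma_d^\circ$ its normalized (probability) spherical Lebesgue measure. $\overline{\mathcal{K}}^d_s$ is the set of spherically convex bodies, i.e. intersections of $\mathbb{S}^d$ with a closed convex cone in $\mathbb{R}^{d+1}$ that is not a linear subspace, with the spherical Hausdorff metric. $U_1(K)=\frac12\int_{\mathbb{S}^d}\mathbf 1\{x^\perp\cap K\neq\emptyset\}\,\sigma_d^\circ(dx)$ for $K\in\overline{\mathcal{K}}^d_s$. A size functional is a continuous map $\Sigma:\overline{\mathcal{K}}^d_s\to[0,\infty)$ with $\Sigma\not\equiv0$ and $\Sigma(\{e\})=0$ for all $e\in\mathbb{S}^d$. Increasing means increasing with respect to set inclusion; rotation invariant means $\Sigma(\varrho K)=\Sigma(K)$ for $\varrho\in\mathrm{SO}(d+1)$. $\Sigma^{-1}([a,\infty))=\{K\in\overline{\mathcal{K}}^d_s:\Sigma(K)\ge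 a\}$. Convention: $\Sigma$ is extended to $\mathbb{S}^d$ by a value with $\Sigma(\mathbb{S}^d)\ge\Sigma(K)$ for all $K\in\overline{\mathcal{K}}^d_s$ (so that $\Sigma$ stays increasing). An isotropic Poisson point process $X$ with intensity $\gamma_s$ is a Poisson process on $\mathbb{S}^d$ with intensity measure $\gamma_s\sigma_d^\circ$. The associated hypersphere tessellation partitions $\mathbb{S}^d$ by the great hyperspheres $\mathbb{S}^d\cap x^\perp$, $x\in X$ (cells are closures of connected components of the complement of their union; if $X$ is empty the only cell is $\mathbb{S}^d$). Fix $\mathsf p\in\mathbb{S}^d$; the Crofton cell $Z_0$ is the almost surely unique cell containing $\mathsf p$ in its interior. *)

(* Defs.v *)
From HB Require Import structures.
From mathcomp Require Export all_boot all_order all_algebra finmap.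
From mathcomp Require Export all_classical all_reals all_analysis.
Export Order.TTheory GRing.Theory Num.Theory.
Export numFieldNormedType.Exports.

Set Implicit Arguments.
Unset Strict Implicit.
Unset Printing Implicit Defensive.

Local Open Scope classical_set_scope.
Local Open Scope ring_scope.

Section Euclidean.
Variable R : realType.

(* The canonical norm `|_| of 'rV[R]_n is the sup norm; it only provides the
   topology here, lengths and angles come from [dot]. *)
Definition dot n (x y : 'rV[R]_n) : R := (x *m y^T) 0 0.

Definition enorm n (x : 'rV[R]_n) : R := Num.sqrt (dot x x).

(* the unit sphere of R^n, of dimension n - 1; S^d is [sphere R d.+1] *)
Definition sphere n : set 'rV[R]_n := [set x | enorm x = 1].

Definition hyperplane n (x : 'rV[R]_n) : set 'rV[R]_n := [set y | dot x y = 0].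

(* row vectors are acted upon from the right *)
Definition special_orthogonal n (A : 'M[R]_n) : Prop :=
  A *m A^T = 1%:M /\ \det A = 1.

Definition borel_rV n := g_sigma_algebraType (@open 'rV[R]_n).

(* n-dimensional Lebesgue measure on Borel sets, as an iterated product measure
   transported along R * R^m = R^(m+1). *)
Fixpoint lebesgue_rV (n : nat) : set (borel_rV n) -> \bar R :=
  match n with
  | 0 => dirac ((0 : 'rV[R]_0) : borel_rV 0)
  | m.+1 => pushforward
      (@lebesgue_measure R \x @lebesgue_rV m)%E
      (fun z : R * borel_rV m => row_mx z.1%:M z.2 : borel_rV m.+1)
  end.

Definition unit_ball n : set (borel_rV n) := [set y : 'rV[R]_n | enorm y <= 1].

Definition punctured_cone n (A : set 'rV[R]_n) : set (borel_rV n) :=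
  [set t *: x | t in `]0, 1]%classic & x in A].

(* Normalized spherical Lebesgue measure, viewed as a Borel measure on R^n carried
   by the sphere: the volume of the cone { t x | x in A, 0 < t <= 1 } over the part
   A of the sphere, divided by the volume of the unit ball. *)
Definition sigma_sphere n (A : set (borel_rV n)) : \bar R :=
  ((fine (lebesgue_rV (@unit_ball n)))^-1%:E *
   lebesgue_rV (punctured_cone (@sphere n `&` A)))%E.

End Euclidean.
Arguments sphere R n : clear implicits.
Arguments sigma_sphere {R n} A.

Section SphericalConvexity.
Variables (R : realType) (n : nat).
Local Notation V := 'rV[R]_n.
Implicit Types (C K L : set V) (Sigma : set V -> R).

Definition closed_convex_cone C : Prop :=
  [/\ closed C, convex_set C, C 0 &
      forall (t : R) (v : V), 0 <= t -> C v -> C (t *: v)].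

Definition linear_subspace C : Prop := exists U : {vspace V}, C = [set` U].

Definition spherical_body K : Prop :=
  exists C, [/\ closed_convex_cone C, ~ linear_subspace C & K = sphere R n `&` C].

Definition sdist (x y : V) : R := acos (dot x y).

Definition shausdorff K L : R :=
  Num.max (sup [set inf [set sdist x y | y in L] | x in K])
          (sup [set inf [set sdist x y | x in K] | y in L]).

Definition U1 K : R :=
  2^-1 * fine (\int[@sigma_sphere R n]_(x in sphere R n)
                 (\1_[set x : V | hyperplane x `&` K !=set0] x)%:E).

Definition hitting_functional K : R := 2 * U1 K.

(* A functional on spherical bodies is a function on all sets of which only the
   values at spherical bodies (and, for the extension, at the whole sphere) matter. *)
Definition body_continuous Sigma : Prop :=
  forall K, spherical_body K -> forall eps : R, 0 < eps ->
  exists2 delta : R, 0 < delta &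
    forall L, spherical_body L -> shausdorff K L < delta ->
      `|Sigma L - Sigma K| < eps.

Definition size_functional Sigma : Prop :=
  [/\ forall K, spherical_body K -> 0 <= Sigma K,
      body_continuous Sigma,
      exists2 K, spherical_body K & Sigma K != 0 &
      forall e, sphere R n e -> Sigma [set e] = 0].

Definition increasing_functional Sigma : Prop :=
  forall K L, spherical_body K -> spherical_body L -> K `<=` L ->
    Sigma K <= Sigma L.

Definition extended_to_sphere Sigma : Prop :=
  forall K, spherical_body K -> Sigma K <= Sigma (sphere R n).

Definition rotation_invariant Sigma : Prop :=
  forall (A : 'M[R]_n) K, special_orthogonal A -> spherical_body K ->
    Sigma ((fun x : V => x *m A) @` K) = Sigma K.

Definition superlevel Sigma (a : R) : set (set V) :=
  [set K | spherical_body K /\ a <= Sigma K].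

Definition tau (Phi Sigma : set V -> R) (a : R) : R :=
  inf [set Phi K | K in superlevel Sigma a].

End SphericalConvexity.

Section PoissonProcess.
Variables (R : realType) (n : nat).
Local Notation V := 'rV[R]_n.

Definition point_count (T : Type) (X : T -> set V) (A : set V) (w : T) : nat :=
  #|` fset_set (X w `&` A)|.

(* A process on the sphere with intensity measure g * sigma_sphere; the intensity
   measure being finite and diffuse, realizations are taken to be finite sets of
   points.  The second argument of [poisson_prob] is not used by the library. *)
Definition isotropic_poisson (dT : measure_display) (T : measurableType dT)
    (P : probability T R) (X : T -> set V) (g : R) : Prop :=
  [/\ forall w, finite_set (X w) /\ X w `<=` sphere R n,
      forall A : set (borel_rV R n), measurable A ->
        measurable_fun setT (point_count X A),
      forall (A : set (borel_rV R n)) (k : nat), measurable A ->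
        P [set w | point_count X A w = k] =
        poisson_prob (g * fine (sigma_sphere A)) 0 [set k] &
      forall (m : nat) (A : 'I_m -> set (borel_rV R n)) (k : 'I_m -> nat),
        (forall i, measurable (A i)) -> trivIset setT A ->
        P (\bigcap_i [set w | point_count X (A i) w = k i]) =
        (\prod_(i < m) P [set w | point_count X (A i) w = k i])%E].

(* the complement, in the sphere, of the great hyperspheres orthogonal to x in Y *)
Definition hypersphere_complement (Y : set V) : set V :=
  sphere R n `\` \bigcup_(x in Y) hyperplane x.

Definition tessellation (Y : set V) : set (set V) :=
  [set closure (connected_component (hypersphere_complement Y) y)
     | y in hypersphere_complement Y].

(* interior relative to the sphere *)
Definition interior_point (Z : set V) (p : V) : Prop :=
  within (sphere R n) (nbhs p) Z.

(* The default value is used only if p lies on one of the great hyperspheres. *)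
Definition crofton_cell (p : V) (Y : set V) : set V :=
  xget (sphere R n) [set Z | tessellation Y Z /\ interior_point Z p].

End PoissonProcess.

(* Main.v *)
Require Import Defs.
From HB Require Import structures.
From mathcomp Require Import unstable measurable_realfun lra ring.

(* Lower bound: rotate a minimizer K of Phi on {Sigma >= a} so that it contains p; it is
   then contained in Z_0 as soon as X avoids {x : x^perp meets K}, an event of
   probability exp (- g Phi K).

   Upper bound: let A_e K be the set of x such that <x, .> takes values above e and
   below - e on K.  Up to a null set, {x : x^perp meets K} is the increasing union of
   the A_e K, and the spherical bodies are sequentially compact, so that some e > 0
   gives sigma (A_e K) > tau - eps for all K in {Sigma >= a} simultaneously.
   Replacing Z_0 by the points of a finite e/2-net near Z_0, the event is covered by
   finitely many events {X avoids A}, with sigma A > tau - eps.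

   The event {Sigma Z_0 >= a} must be shown to be measurable: rounding the points of X
   to finer and finer grids approximates Sigma Z_0 by discrete random variables. *)

Set Implicit Arguments.
Unset Strict Implicit.
Unset Printing Implicit Defensive.

Local Open Scope classical_set_scope.
Local Open Scope ring_scope.

(** * The Euclidean structure and the sphere *)

(** The obstacle is semicontinuity: a hyperplane that merely supports [K] can be lost under an
    arbitrarily small move of [K]. A crossing with margin [e], in contrast, survives with margin e'
    any displacement of at most e - e'. This trade of margin against distance gives the existence of
    the minimizer, the uniform [e] and the passage to the net. What it neglects, the normals of
    supporting hyperplanes, is null because it has infinitely many disjoint translates.

    Crossing implies hitting only because a body is not cut out by a subspace: two antipodal points
    are crossed by hyperplanes that miss them. Not being a subspace is not visibly stable under
    limits, so it is carried by a witness, a pole: a point of the body with nonnegative inner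
    product with the whole body.

    The Crofton cell is replaced by the intersection [cell] of half-spaces. The whole sphere, which
    is not a body, appears in two degenerate cases: [X] empty, which is one more avoidance event,
    and [p] on a great hypersphere, which has probability zero. *)

Lemma continuous_sum (R : realType) (T : topologicalType) (I : Type) (r : seq I)
    (f : I -> T -> R) :
  (forall i, continuous (f i)) -> continuous (fun x => \sum_(i <- r) f i x).
Proof.
move=> cf; elim: r => [|i r IH].
  rewrite (_ : (fun _ => _) = cst 0); first by move=> x; exact: cvg_cst.
  by apply/funext => x; rewrite big_nil.
rewrite (_ : (fun _ => _) = fun x => f i x + \sum_(j <- r) f j x); last first.
  by apply/funext => x; rewrite big_cons.
by move=> x; apply: cvgD; [exact: cf | exact: IH].
Qed.

Lemma continuous_mul (R : realType) (T : topologicalType) (f g : T -> R) :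
  continuous f -> continuous g -> continuous (fun x => f x * g x).
Proof. by move=> cf cg x; apply: cvgM; [exact: cf | exact: cg]. Qed.

Section Dot.
Variables (R : realType) (n : nat).
Implicit Types (x y z : 'rV[R]_n) (t : R).

Lemma dotE x y : dot x y = \sum_i x 0 i * y 0 i.
Proof. by rewrite /dot mxE; apply: eq_bigr => i _; rewrite mxE. Qed.

Lemma dotC x y : dot x y = dot y x.
Proof. by rewrite !dotE; apply: eq_bigr => i _; rewrite mulrC. Qed.

Lemma dotDl x y z : dot (x + y) z = dot x z + dot y z.
Proof. by rewrite /dot mulmxDl mxE. Qed.

Lemma dotZl t x y : dot (t *: x) y = t * dot x y.
Proof. by rewrite /dot -scalemxAl mxE. Qed.

Lemma dotNl x y : dot (- x) y = - dot x y.
Proof. by rewrite /dot mulNmx mxE. Qed.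

Lemma dotBl x y z : dot (x - y) z = dot x z - dot y z.
Proof. by rewrite dotDl dotNl. Qed.

Lemma dot0l x : dot 0 x = 0.
Proof. by rewrite /dot mul0mx mxE. Qed.

Lemma dotDr x y z : dot z (x + y) = dot z x + dot z y.
Proof. by rewrite !(dotC z) dotDl. Qed.

Lemma dotZr t x y : dot y (t *: x) = t * dot y x.
Proof. by rewrite !(dotC y) dotZl. Qed.

Lemma dotNr x y : dot y (- x) = - dot y x.
Proof. by rewrite !(dotC y) dotNl. Qed.

Lemma dotBr x y z : dot z (x - y) = dot z x - dot z y.
Proof. by rewrite !(dotC z) dotBl. Qed.

Lemma dot0r x : dot x 0 = 0.
Proof. by rewrite dotC dot0l. Qed.

Lemma dotxx_ge0 x : 0 <= dot x x.
Proof. by rewrite dotE sumr_ge0// => i _; rewrite -expr2 sqr_ge0. Qed.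

Lemma dotxx_eq0 x : (dot x x == 0) = (x == 0).
Proof.
apply/eqP/eqP => [|->]; last exact: dot0l.
rewrite dotE => /eqP; rewrite psumr_eq0; last by move=> i _; rewrite -expr2 sqr_ge0.
move=> /allP h; apply/rowP => i; rewrite mxE.
by have := h i (mem_index_enum i); rewrite mulf_eq0 orbb => /eqP.
Qed.

Lemma sqr_coord_le_dot x i : x 0 i ^+ 2 <= dot x x.
Proof.
rewrite dotE (bigD1 i)//= -expr2 lerDl sumr_ge0// => j _.
by rewrite -expr2 sqr_ge0.
Qed.

Lemma dot_mulmx (M : 'M[R]_n) x y : dot (x *m M) y = dot x (y *m M^T).
Proof. by rewrite /dot trmx_mul trmxK mulmxA. Qed.

Lemma enorm_ge0 x : 0 <= enorm x.
Proof. exact: sqrtr_ge0. Qed.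

Lemma sqr_enorm x : enorm x ^+ 2 = dot x x.
Proof. by rewrite sqr_sqrtr// dotxx_ge0. Qed.

Lemma enorm_eq0 x : (enorm x == 0) = (x == 0).
Proof. by rewrite -dotxx_eq0 -sqr_enorm sqrf_eq0. Qed.

Lemma enorm0 : enorm (0 : 'rV[R]_n) = 0.
Proof. by apply/eqP; rewrite enorm_eq0. Qed.

Lemma enorm_gt0 x : (0 < enorm x) = (x != 0).
Proof. by rewrite lt_def enorm_ge0 andbT enorm_eq0. Qed.

Lemma enormZ t x : enorm (t *: x) = `|t| * enorm x.
Proof. by rewrite /enorm dotZl dotZr mulrA -expr2 sqrtrM ?sqr_ge0// sqrtr_sqr. Qed.

Lemma enormN x : enorm (- x) = enorm x.
Proof. by rewrite -scaleN1r enormZ normrN1 mul1r. Qed.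

Lemma enormB x y : enorm (x - y) = enorm (y - x).
Proof. by rewrite -enormN opprB. Qed.

Lemma dot_le_enorm x y : `|dot x y| <= enorm x * enorm y.
Proof.
rewrite -(@ler_sqr R) ?nnegrE ?mulr_ge0 ?enorm_ge0// exprMn !sqr_enorm real_normK ?num_real//.
have [->|y0] := eqVneq y 0; first by rewrite !dot0r expr0n mulr0.
have yy : 0 < dot y y by rewrite lt_def dotxx_eq0 y0 dotxx_ge0.
(* The squared norm of this vector is <y, y> (<x, x> <y, y> - <x, y>^2). *)
have := dotxx_ge0 (dot y y *: x - dot x y *: y).
rewrite dotBl !dotBr !dotZl !dotZr (dotC y x) => h.
by rewrite -(ler_pM2l yy); nra.
Qed.

Lemma enormD x y : enorm (x + y) <= enorm x + enorm y.
Proof.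
rewrite -(@ler_sqr R) ?nnegrE ?addr_ge0 ?enorm_ge0// sqr_enorm dotDl !dotDr.
have := dot_le_enorm x y; rewrite ler_norml => /andP[_ h].
by rewrite sqrrD !sqr_enorm (dotC y x); lra.
Qed.

Lemma enorm_sub_le x y z : enorm (x - z) <= enorm (x - y) + enorm (y - z).
Proof. by rewrite -(subrKA y) enormD. Qed.

Lemma coord_le_enorm x i : `|x 0 i| <= enorm x.
Proof.
rewrite -(@ler_sqr R) ?nnegrE ?enorm_ge0// sqr_enorm real_normK ?num_real//.
exact: sqr_coord_le_dot.
Qed.

Lemma enorm_mulmx (M : 'M[R]_n) x : M *m M^T = 1%:M -> enorm (x *m M) = enorm x.
Proof. by move=> MM; rewrite /enorm dot_mulmx -mulmxA MM mulmx1. Qed.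

Lemma continuous_dotl y : continuous (fun x => dot x y).
Proof.
rewrite (_ : (fun _ => _) = fun x => \sum_i x 0 i * y 0 i); last first.
  by apply/funext => x; exact: dotE.
apply: continuous_sum => i; apply: (@continuous_mul R 'rV[R]_n (fun x => x 0 i) (fun=> y 0 i)).
  exact: coord_continuous.
exact: cst_continuous.
Qed.

Lemma continuous_dotr y : continuous (dot y).
Proof.
rewrite (_ : dot y = fun x => dot x y); first exact: continuous_dotl.
by apply/funext => x; exact: dotC.
Qed.

Lemma continuous_enorm : continuous (@enorm R n).
Proof.
move=> x; apply: (@continuous_comp _ _ _ (fun x : 'rV[R]_n => dot x x) Num.sqrt);
  last exact: sqrt_continuous.
rewrite (_ : (fun x => dot x x) = fun x => \sum_i x 0 i * x 0 i); last first.
  by apply/funext => z; exact: dotE.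
apply: continuous_sum => i.
by apply: (@continuous_mul R 'rV[R]_n (fun x => x 0 i) (fun x => x 0 i));
  exact: coord_continuous.
Qed.

End Dot.

Section Sphere.
Variables (R : realType) (n : nat).
Implicit Types (x y z : 'rV[R]_n) (t : R).
Local Notation S := (sphere R n).

Lemma sphere_dot x : S x -> dot x x = 1.
Proof. by rewrite /sphere/= -sqr_enorm => ->; rewrite expr1n. Qed.

Lemma sphere_neq0 x : S x -> x != 0.
Proof. by rewrite -enorm_eq0 => ->; rewrite oner_eq0. Qed.

Lemma sphereN x : S x -> S (- x).
Proof. by rewrite /sphere/= enormN. Qed.

Lemma sphere_delta_mx (i : 'I_n) : S (delta_mx 0 i).
Proof.
rewrite /sphere/= /enorm dotE (bigD1 i)//= big1 => [|j ji].
  by rewrite !mxE !eqxx/= mulr1 addr0 sqrtr1.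
by rewrite !mxE eqxx/= (negPf ji) mul0r.
Qed.

Definition normalize x := (enorm x)^-1 *: x.

Lemma normalize_sphere x : x != 0 -> S (normalize x).
Proof.
rewrite -enorm_gt0 => x0; rewrite /sphere/= enormZ ger0_norm ?invr_ge0 ?enorm_ge0//.
by rewrite mulVf// gt_eqF.
Qed.

Lemma closed_sphere : closed S.
Proof.
rewrite (_ : S = @enorm R n @^-1` [set 1])//.
by apply: preimage_closed; [move=> x _; exact: continuous_enorm | exact: closed_eq].
Qed.

Lemma compact_sphere : compact S.
Proof.
apply: bounded_closed_compact; last exact: closed_sphere.
exists 1; split => // M M1 x Sx; change (mx_norm x <= M); rewrite mx_normrE.
apply/bigmax_leP; split; first by lra.
move=> [i j] _ /=; rewrite ord1; apply: le_trans (coord_le_enorm _ _) _.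
by rewrite Sx ltW.
Qed.

(** One half of the comparison of the Euclidean norm with the topology, which comes from the sup
    norm; the other half is [nbhs_enorm]. *)
Lemma enorm_ball x e : 0 < e -> nbhs x [set y | enorm (x - y) < e].
Proof.
move=> e0; pose f y := enorm (x - y).
have cf : continuous f.
  move=> y; apply: (@continuous_comp 'rV[R]_n 'rV[R]_n R (fun y => x - y) (@enorm R n)).
    apply: (@continuousB R 'rV[R]_n 'rV[R]_n (cst x) id); last exact: cvg_id.
    exact: cst_continuous.
  exact: continuous_enorm.
have : nbhs (f x) [set t : R | t < e].
  by apply: open_nbhs_nbhs; split; [exact: open_lt | rewrite /f/= subrr enorm0].
exact: cf.
Qed.

End Sphere.

(** * Lebesgue measure on row vectors *)

Definition image_measure d d' (T1 : measurableType d) (T2 : measurableType d')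
    (R : realType) (m : {measure set T1 -> \bar R}) (f : T1 -> T2)
    (mf : measurable_fun setT f) : {measure set T2 -> \bar R} :=
  measure_function_pushforward__canonical__measure_function_Measure m mf.

Section BorelRowVectors.
Variable R : realType.

Lemma open_measurable_rV n (U : set 'rV[R]_n) :
  open U -> measurable (U : set (borel_rV R n)).
Proof. by move=> oU; apply: sub_sigma_algebra. Qed.

Lemma closed_measurable_rV n (U : set 'rV[R]_n) :
  closed U -> measurable (U : set (borel_rV R n)).
Proof.
move=> cU; rewrite -(setCK U); apply: measurableC.
by apply: open_measurable_rV; exact: closed_openC.
Qed.

Lemma continuous_measurable_rV n (f : 'rV[R]_n -> R) :
  continuous f -> measurable_fun setT (f : borel_rV R n -> R).
Proof.
move=> cf; apply: (measurability _ (RGenOpens.measurableE R)).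
move=> _ [_ [a [b ->] <-]]; rewrite setTI; apply: open_measurable_rV.
by apply: open_comp; [move=> x _; exact: cf | exact: interval_open].
Qed.

Lemma measurable_coord n (i : 'I_n) :
  measurable_fun setT (fun x : borel_rV R n => (x : 'rV[R]_n) 0 i).
Proof. by apply: continuous_measurable_rV; exact: coord_continuous. Qed.

(** An open set is the union of the rational boxes that it contains, and there are countably many of
    them. Hence the Borel sets of row vectors are controlled by the coordinates. *)
Lemma measurable_fun_rV d (T : measurableType d) n (f : T -> borel_rV R n) :
  (forall i, measurable_fun setT (fun t => (f t : 'rV[R]_n) 0 i)) ->
  measurable_fun setT f.
Proof.
move=> mf; apply: (@measurability _ _ T (borel_rV R n) setT f (@open 'rV[R]_n)) => //.
move=> _ [U oU <-].
rewrite setTI.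
pose box (q : 'rV[rat]_n * rat) : set 'rV[R]_n :=
  [set y | forall i, `|y 0 i - ratr (q.1 0 i)| < ratr q.2].
pose F q : set T := [set t | box q `<=` U /\ box q (f t)].
have -> : f @^-1` U = \bigcup_q F q.
  apply/seteqP; split=> [t Ut|t [q _ [qU]]]; last exact: qU.
  have /nbhs_ballP[e /= e0 eU] : nbhs (f t : 'rV[R]_n) U by exact: open_nbhs_nbhs.
  have /rat_in_itvoo[r] : 0 < e / 2 by lra.
  rewrite in_itv/= => /andP[r0 re].
  have /choice[q qP] : forall i, exists q : rat,
      `|(f t : 'rV[R]_n) 0 i - ratr q| < ratr r.
    move=> i; have /rat_in_itvoo[q] : (f t : 'rV[R]_n) 0 i - ratr r <
        (f t : 'rV[R]_n) 0 i + ratr r by lra.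
    by rewrite in_itv/= => q_; exists q; rewrite ltr_distlC; lra.
  exists (\row_i q i, r) => //; split=> [y yb|i]; last by rewrite mxE.
  apply: eU; split=> // i j; rewrite ord1 /ball/=.
  have := yb j; have := qP j; rewrite /= !mxE => h1 h2.
  rewrite -(subrKA (ratr (q j))) (le_lt_trans (ler_normD _ _))//.
  by rewrite (distrC (ratr _)); lra.
apply: countable_bigcupT_measurable => // q.
have [qU|nqU] := pselect (box q `<=` U); last first.
  by rewrite (_ : F q = set0)// -subset0 => t [].
have -> : F q = \bigcap_(i in [set: 'I_n])
    ((fun t => (f t : 'rV[R]_n) 0 i) @^-1`
       [set y | `|y - ratr (q.1 0 i)| < ratr q.2]).
  by apply/seteqP; split=> [t [_ bt] i _|t bt]; [exact: bt | split=> // i; exact: bt].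
apply: fin_bigcap_measurable => // i _.
rewrite -[X in measurable X]setTI; apply: mf => //.
rewrite (_ : [set _ | _] = ball (ratr (q.1 0 i) : R) (ratr q.2)).
  exact: measurable_ball.
by apply/seteqP; split=> y; rewrite /ball/= distrC.
Qed.

Lemma row_mx_coord0 m (a : R) (y : 'rV[R]_m) j :
  (row_mx a%:M y : 'rV[R]_m.+1) 0 (lshift m (j : 'I_1)) = a.
Proof. by rewrite [LHS]row_mxEl mxE ord1. Qed.

Lemma row_mx_coordS m (a : R) (y : 'rV[R]_m) j :
  (row_mx a%:M y : 'rV[R]_m.+1) 0 (rshift 1 (j : 'I_m)) = y 0 j.
Proof. exact: row_mxEr. Qed.

Lemma measurable_row_mx m :
  measurable_fun setT
    (fun z : R * borel_rV R m => row_mx z.1%:M z.2 : borel_rV R m.+1).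
Proof.
apply: measurable_fun_rV => i.
case: (@split_ordP 1 m i) => j ->.
  rewrite (_ : (fun _ => _) = fst); first exact: measurable_fst.
  by apply/funext => t; rewrite row_mx_coord0.
rewrite (_ : (fun _ => _) = (fun x : borel_rV R m => (x : 'rV[R]_m) 0 j) \o snd).
  by apply: measurableT_comp; [exact: measurable_coord | exact: measurable_snd].
by apply/funext => t; rewrite row_mx_coordS.
Qed.

(** Cubes rather than balls: under [row_mx] they factor as products, so that their measure is
    computable by induction on the dimension. *)
Definition rV_box n (k : R) : set (borel_rV R n) :=
  [set y : 'rV[R]_n | forall i, `|y 0 i| <= k].

Lemma rV_boxS m (k a : R) (y : 'rV[R]_m) :
  @rV_box m.+1 k (row_mx a%:M y) = (`|a| <= k /\ rV_box k y).
Proof.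
apply/propext; split=> [h|[ak yk] i].
  split=> [|i]; first by have := h (lshift m (0 : 'I_1)); rewrite row_mx_coord0.
  by have := h (rshift 1 i); rewrite row_mx_coordS.
case: (@split_ordP 1 m i) => j ->; first by rewrite row_mx_coord0.
by rewrite row_mx_coordS.
Qed.

Lemma measurable_rV_box n (k : R) : measurable (@rV_box n k).
Proof.
have -> : @rV_box n k = \bigcap_(i in [set: 'I_n])
    ((fun y : borel_rV R n => (y : 'rV[R]_n) 0 i) @^-1` `[- k, k]%classic).
  apply/seteqP; split=> y yk i; first by move=> _; rewrite /= in_itv/= -ler_norml.
  by have := yk i I; rewrite /= in_itv/= -ler_norml.
apply: fin_bigcap_measurable => // i _.
by rewrite -[X in measurable X]setTI; exact: measurable_coord.
Qed.

(** [lebesgue_rV] is defined as a bare set function. Its measure structure and sigma-finiteness must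
    be built along the recursion, since each product uses sigma-finiteness of the previous factor;
    finiteness on cubes provides the exhaustion. *)
Lemma lebesgue_rV_measure n :
  exists mu : {sigma_finite_measure set (borel_rV R n) -> \bar R},
    (mu : set _ -> _) = @lebesgue_rV R n /\ forall k, (mu (rV_box k) < +oo)%E.
Proof.
elim: n => [|m [mu [muE mufin]]].
  exists (\d_((0 : 'rV[R]_0) : borel_rV R 0)); split=> // k.
  by rewrite [X in (X < _)%E]diracE ltry.
pose f z : borel_rV R m.+1 := row_mx (z : R * borel_rV R m).1%:M z.2.
have mf : measurable_fun setT f := @measurable_row_mx m.
pose nu := image_measure (@lebesgue_measure R \x mu)%E mf.
have nufin k : (nu (rV_box k) < +oo)%E.
  have -> : nu (rV_box k) =
      (@lebesgue_measure R \x mu)%E (`[- k, k]%classic `*` rV_box k).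
    rewrite /nu/= /pushforward; congr (_ _).
    apply/seteqP; split=> -[a y]; rewrite /f /= rV_boxS in_itv/= -ler_norml.
      by case.
    by case.
  rewrite product_measure1E//; last exact: measurable_rV_box.
  by rewrite lte_mul_pinfty// [X in X \is a _]lebesgue_measure_itv/=; case: ifP.
have nusf : sigma_finite setT nu.
  exists (fun k => rV_box k%:R); last first.
    by move=> k; split; [exact: measurable_rV_box | exact: nufin].
  apply/seteqP; split=> // y _.
  have [k yk] : exists k : nat, forall i, `|(y : 'rV[R]_m.+1) 0 i| <= k%:R.
    exists (Num.trunc (\big[Num.max/0]_i `|(y : 'rV[R]_m.+1) 0 i|)).+1 => i.
    apply: ltW; apply: le_lt_trans (truncnS_gt _).
    exact: (le_bigmax _ (fun i => `|(y : 'rV[R]_m.+1) 0 i|)).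
  by exists k.
pose M : {sigma_finite_measure set (borel_rV R m.+1) -> \bar R} :=
  HB.pack (nu : set _ -> _) (Measure.class nu) (Measure_isSigmaFinite.Build _ _ _ nu nusf).
by exists M; split=> //=; rewrite -muE.
Qed.


Definition lebesgue_rV_sigma_finite n :
    {sigma_finite_measure set (borel_rV R n) -> \bar R} :=
  projT1 (cid (lebesgue_rV_measure n)).
Local Notation lam := lebesgue_rV_sigma_finite.

Lemma lebesgue_rV_sigma_finiteE n : (@lam n : set _ -> _) = @lebesgue_rV R n.
Proof. by rewrite /lam; case: cid => mu /= []. Qed.

Lemma lebesgue_rV_box n k : (lam n (rV_box k) < +oo)%E.
Proof. by rewrite /lam; case: cid => mu /= []. Qed.

Lemma lebesgue_measure_translate (c : R) (A : set R) : measurable A ->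
  lebesgue_measure ((fun x => x + c) @^-1` A) = lebesgue_measure A :> \bar R.
Proof.
pose f : measurableTypeR R -> measurableTypeR R := fun x => x + c.
have mf : measurable_fun setT f by exact: measurable_funD.
move=> mA; apply/esym.
apply: (@lebesgue_measure_unique R (image_measure lebesgue_measure mf)) => // X.
move=> [[a b] _ <-].
rewrite //= /pushforward (_ : _ @^-1` _ = `]a - c, b - c]%classic).
  rewrite !lebesgue_measure_itv/= !lte_fin ltrD2r -!EFinB.
  by rewrite (_ : b - c - (a - c) = b - a)//; ring.
by apply/seteqP; split=> x; rewrite /f/= !in_itv/= ltrBlDr lerBrDr.
Qed.

Lemma ge0_integral_translate (c : R) (f : R -> \bar R) :
  measurable_fun setT f -> (forall x, 0 <= f x)%E ->
  (\int[lebesgue_measure]_x f (x + c)%R)%E = (\int[lebesgue_measure]_x f x)%E.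
Proof.
move=> mf f0; pose t : measurableTypeR R -> measurableTypeR R := fun x => x + c.
have mt : measurable_fun setT t by exact: measurable_funD.
transitivity (\int[image_measure lebesgue_measure mt]_x f x)%E.
  by rewrite (ge0_integral_pushforward mt).
by apply: eq_measure_integral => A mA _; exact: lebesgue_measure_translate.
Qed.

Lemma lebesgue_rVS m (A : set (borel_rV R m.+1)) :
  lam m.+1 A = (\int[lebesgue_measure]_a lam m [set y | A (row_mx (a : R)%:M (y : 'rV[R]_m))])%E.
Proof.
rewrite lebesgue_rV_sigma_finiteE /= /pushforward -lebesgue_rV_sigma_finiteE.
rewrite /product_measure1; apply: eq_integral => a _ /=; congr (_ _).
by apply/seteqP; split=> y; rewrite /xsection/= inE.
Qed.

Lemma measurable_addr_rV n (v : 'rV[R]_n) :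
  measurable_fun setT (fun y : borel_rV R n => (y : 'rV[R]_n) + v : borel_rV R n).
Proof.
apply: measurable_fun_rV => i.
rewrite (_ : (fun _ => _) = (fun y : borel_rV R n => (y : 'rV[R]_n) 0 i + v 0 i)).
  by apply: measurable_funD => //; exact: measurable_coord.
by apply/funext => y; rewrite mxE.
Qed.

(** Slicing along the first coordinate: the shift of that coordinate is absorbed by invariance on
    the line, the shift of each slice by induction. *)
Lemma lebesgue_rV_translate n (v : 'rV[R]_n) (A : set (borel_rV R n)) :
  measurable A ->
  lam n [set y | A ((y : 'rV[R]_n) + v : borel_rV R n)] = lam n A.
Proof.
elim: n => [|m IH] in v A *.
  by move=> _; congr (_ _); apply/seteqP; split=> y /=; rewrite (thinmx0 v) addr0.
move=> mA; rewrite !lebesgue_rVS.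
pose h (a : R) := lam m [set y | A (row_mx a%:M (y : 'rV[R]_m))].
pose E := (fun z : R * borel_rV R m => row_mx z.1%:M z.2 : borel_rV R m.+1) @^-1` A.
have mE : measurable E.
  by rewrite -[X in measurable X]setTI; exact: measurable_row_mx.
have secE (a : R) : [set y | A (row_mx a%:M (y : 'rV[R]_m))] = xsection E a.
  by apply/seteqP; split=> y; rewrite /xsection/= inE.
have msec (a : R) : measurable [set y : borel_rV R m | A (row_mx a%:M (y : 'rV[R]_m))].
  by rewrite secE; exact: measurable_xsection.
have mh : measurable_fun setT h.
  rewrite (_ : h = lam m \o xsection E); first exact: measurable_fun_xsection.
  by apply/funext => a; rewrite /h secE.
rewrite -(ge0_integral_translate (v 0 0) mh)//.
apply: eq_integral => a _; rewrite /h.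
rewrite -(IH (\row_j v 0 (rshift 1 j)) _ (msec _)); congr (_ _).
have vE y : row_mx a%:M y + v =
    row_mx (a + v 0 0)%:M (y + \row_j v 0 (rshift 1 j)) :> 'rV[R]_m.+1.
  apply/rowP => i; rewrite mxE; case: (@split_ordP 1 m i) => j ->.
    by rewrite !row_mx_coord0 (ord1 j); congr (_ + v _ _); exact/val_inj.
  by rewrite !row_mx_coordS !mxE.
by apply/seteqP; split=> y /=; rewrite vE.
Qed.

Lemma measurable_add_mulmx n (M : 'M[R]_n) :
  measurable_fun setT (fun z : borel_rV R n * borel_rV R n =>
    (z.1 : 'rV[R]_n) + (z.2 : 'rV[R]_n) *m M : borel_rV R n).
Proof.
apply: measurable_fun_rV => i.
rewrite (_ : (fun _ => _) = (fun z : borel_rV R n * borel_rV R n =>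
    (z.1 : 'rV[R]_n) 0 i + \sum_j (z.2 : 'rV[R]_n) 0 j * M j i)); last first.
  by apply/funext => z; rewrite !mxE.
apply: measurable_funD.
  by apply: (measurableT_comp (measurable_coord i)); exact: measurable_fst.
apply: measurable_sum => j; apply: measurable_funM => //.
by apply: (measurableT_comp (measurable_coord j)); exact: measurable_snd.
Qed.

Lemma measurable_mulmx n (M : 'M[R]_n) :
  measurable_fun setT (fun y : borel_rV R n => (y : 'rV[R]_n) *m M : borel_rV R n).
Proof.
rewrite (_ : (fun _ => _) = (fun z : borel_rV R n * borel_rV R n =>
    (z.1 : 'rV[R]_n) + (z.2 : 'rV[R]_n) *m M : borel_rV R n) \o pair (0 : 'rV[R]_n)).
  apply: measurableT_comp; [exact: measurable_add_mulmx | exact: pair1_measurable].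
by apply/funext => y /=; rewrite add0r.
Qed.

(* Computing in two ways the measure of [{(x, y) | x \in A, x + y M \in B}],
   as in the proof of uniqueness of Haar measure. *)
Lemma lebesgue_rV_mulmx_exchange n (M M' : 'M[R]_n) (A B : set (borel_rV R n)) :
  M' *m M = 1%:M -> measurable A -> measurable B ->
  (lam n A * lam n [set y | B ((y : 'rV[R]_n) *m M : borel_rV R n)] =
   lam n B * lam n [set y | A ((y : 'rV[R]_n) *m (- M) : borel_rV R n)])%E.
Proof.
move=> MM mA mB.
pose shear (C D : set (borel_rV R n)) (N : 'M[R]_n) : set (borel_rV R n * borel_rV R n) :=
  [set z | C z.1 /\ D ((z.1 : 'rV[R]_n) + (z.2 : 'rV[R]_n) *m N : borel_rV R n)].
pose pre (D : set (borel_rV R n)) (N : 'M[R]_n) : set (borel_rV R n) :=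
  [set y : 'rV[R]_n | D (y *m N : borel_rV R n)].
have mshear C D N : measurable C -> measurable D -> measurable (shear C D N).
  move=> mC mD; apply: measurableI; rewrite -[X in measurable X]setTI.
    exact: measurable_fst.
  exact: measurable_add_mulmx.
have mpre D N : measurable D -> measurable (pre D N).
  by move=> mD; rewrite -[X in measurable X]setTI; exact: measurable_mulmx.
have key C D N N' : N' *m N = 1%:M -> measurable C -> measurable D ->
    (\int[lam n]_x lam n (xsection (shear C D N) x) = lam n C * lam n (pre D N))%E.
  move=> NN mC mD.
  transitivity (\int[lam n]_x (lam n (pre D N) * (\1_C x)%:E))%E.
    apply: eq_integral => x _; rewrite indicE.
    have [xC|xC] := boolP (x \in C); last first.
      rewrite mule0 (_ : xsection _ x = set0) ?measure0//.
      rewrite -subset0 => y; rewrite /xsection/= inE/= => -[Cx _].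
      by move: xC; rewrite notin_setE.
    rewrite mule1 -(lebesgue_rV_translate ((x : 'rV[R]_n) *m N') (mpre D N mD)).
    congr (_ _); apply/seteqP; split=> y; rewrite /xsection /pre /= inE/=;
      rewrite mulmxDl -mulmxA NN mulmx1 addrC.
      by case.
    by split => //; move: xC; rewrite inE.
  rewrite ge0_integralZl//; first by rewrite integral_indic// setIT muleC.
  by apply/measurable_EFinP; exact: measurable_indic.
(* With z = x + y M both sides measure the same pairs, x in [A] and z in [B], parametrized by (x, y)
   or by (z, y). For fixed y the two sections are translates of each other by y M. *)
rewrite -(key A B M M')// -(key B A (- M) (- M'))//; last first.
  by rewrite mulNmx mulmxN opprK.
have tonelli V : measurable V ->
   (\int[lam n]_x lam n (xsection V x) = \int[lam n]_y lam n (ysection V y))%E.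
  move=> mV; have := indic_fubini_tonelli (lam n) (lam n) mV.
  by rewrite indic_fubini_tonelli_FE// indic_fubini_tonelli_GE.
have mAB : measurable (shear A B M) by exact: mshear.
rewrite !tonelli//; last exact: mshear.
apply: eq_integral => y _.
rewrite -(lebesgue_rV_translate (- ((y : 'rV[R]_n) *m M)) (measurable_ysection y mAB)).
congr (_ _); apply/seteqP; split=> x; rewrite /ysection /shear/= !inE/= mulmxN.
  by rewrite subrK; case.
by rewrite subrK; case.
Qed.

End BorelRowVectors.

(** * Spherical Lebesgue measure *)

Section SphericalMeasure.
Variables (R : realType) (n : nat).
Local Notation V := 'rV[R]_n.
Local Notation B := (borel_rV R n).
Local Notation S := (sphere R n).
Local Notation lam := (@lebesgue_rV_sigma_finite R n).

Lemma measurable_unit_ball : measurable (@unit_ball R n).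
Proof.
apply: closed_measurable_rV.
rewrite (_ : @unit_ball R n = @enorm R n @^-1` [set t | t <= 1])//.
by apply: preimage_closed; [move=> x _; exact: continuous_enorm | exact: closed_le].
Qed.

Lemma lebesgue_unit_ball : (lam (@unit_ball R n) < +oo)%E.
Proof.
apply: le_lt_trans (lebesgue_rV_box n 1); apply: le_measure; rewrite ?inE.
- exact: measurable_unit_ball.
- exact: measurable_rV_box.
- by move=> x x1 i; apply: le_trans (coord_le_enorm _ _) x1.
Qed.

Local Notation b := (fine (lebesgue_rV (@unit_ball R n))).

(** The exchange identity tested against the unit ball, which an orthogonal matrix preserves. The
    factor [b] is cancelled only in [sigma_sphere_mulmx], where b = 0 makes both sides vanish. *)
Lemma lebesgue_rV_mulmx (M : 'M[R]_n) (A : set B) : M *m M^T = 1%:M -> measurable A ->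
  (b%:E * lam [set y : V | A (y *m M : B)] = b%:E * lam A)%E.
Proof.
move=> MM mA; have MM' : - M^T *m - M = 1%:M.
  by rewrite mulNmx mulmxN opprK; apply: mulmx1C.
have := lebesgue_rV_mulmx_exchange MM' mA measurable_unit_ball.
rewrite opprK (_ : [set y : V | unit_ball _] = @unit_ball R n).
  rewrite -lebesgue_rV_sigma_finiteE fineK 1?muleC => [->//|].
  by rewrite ge0_fin_numE// lebesgue_unit_ball.
by apply/seteqP; split=> y; rewrite /unit_ball/= mulmxN enormN enorm_mulmx.
Qed.

Lemma measurable_normalize : measurable_fun setT (@normalize R n : B -> B).
Proof.
apply: measurable_fun_rV => i.
rewrite (_ : (fun _ => _) = (fun y : B => enorm (y : V) `^ (-1) * (y : V) 0 i)).
  apply: measurable_funM; last exact: measurable_coord.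
  apply: (measurableT_comp (measurable_powR _)).
  by apply: continuous_measurable_rV; exact: continuous_enorm.
by apply/funext => y; rewrite powR_inv1 ?enorm_ge0// mxE.
Qed.

Definition punctured_ball : set B := unit_ball (n := n) `&` [set y | (y : V) != 0].

Lemma measurable_punctured_ball : measurable punctured_ball.
Proof.
apply: measurableI; first exact: measurable_unit_ball.
rewrite (_ : [set _ | _] = @enorm R n @^-1` [set t | 0 < t]); last first.
  by apply/seteqP; split=> y; rewrite /= enorm_gt0.
apply: open_measurable_rV; apply: open_comp; last exact: open_gt.
by move=> x _; exact: continuous_enorm.
Qed.

(** The cone over [A] is a preimage under [normalize]; this exhibits [sigma_sphere] as a scaled
    pushforward of restricted Lebesgue measure, hence as a measure. *)
Lemma punctured_coneE (A : set B) :
  punctured_cone (S `&` A) = @normalize R n @^-1` A `&` punctured_ball.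
Proof.
apply/seteqP; split=> [y [t]|y [Ay [y1 y0]]].
  rewrite /= in_itv/= => /andP[t0 t1] [x [Sx Ax] <-]; rewrite /punctured_ball/=.
  rewrite /normalize /unit_ball/= enormZ Sx mulr1 gtr0_norm// scalerA mulVf ?gt_eqF// scale1r.
  by split=> //; split=> //; rewrite scaler_eq0 negb_or gt_eqF//= sphere_neq0.
have e0 : 0 < enorm (y : V) by rewrite enorm_gt0.
exists (enorm (y : V)); first by rewrite /= in_itv/= e0 y1.
exists (normalize (y : V)); first by split=> //; exact: normalize_sphere.
by rewrite /normalize scalerA divff ?scale1r// gt_eqF.
Qed.

Let b_inv_ge0 : 0 <= b^-1.
Proof. by rewrite invr_ge0 fine_ge0// -lebesgue_rV_sigma_finiteE. Qed.

Definition sigma_measure : {measure set B -> \bar R} :=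
  mscale (NngNum b_inv_ge0)
    (image_measure (mrestr lam measurable_punctured_ball) measurable_normalize).

Lemma sigma_sphereE : @sigma_sphere R n = sigma_measure.
Proof.
apply/funext => A; rewrite /sigma_sphere punctured_coneE.
by rewrite /sigma_measure/= /mscale/= /pushforward /mrestr -lebesgue_rV_sigma_finiteE.
Qed.

Local Notation sigma := (@sigma_sphere R n).

Lemma sigma_sphere_fin_num A : measurable A -> sigma A \is a fin_num.
Proof.
move=> mA; rewrite sigma_sphereE ge0_fin_numE// /sigma_measure/= /mscale/=.
rewrite lte_mul_pinfty//; apply: le_lt_trans lebesgue_unit_ball.
apply: le_measure; rewrite ?inE.
- apply: measurableI; last exact: measurable_punctured_ball.
  by rewrite -[X in measurable X]setTI; exact: measurable_normalize.
- exact: measurable_unit_ball.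
- by move=> x [_ []].
Qed.

Lemma sigma_sphere_le A C : measurable A -> measurable C -> A `<=` C ->
  (sigma A <= sigma C)%E.
Proof. by move=> mA mC AC; rewrite sigma_sphereE le_measure// inE. Qed.

Lemma sigma_sphereU_le A C : measurable A -> measurable C ->
  (sigma (A `|` C) <= sigma A + sigma C)%E.
Proof. by move=> mA mC; rewrite sigma_sphereE measureU2. Qed.

Lemma sigma_sphere_ge0 (A : set B) : measurable A -> (0 <= sigma A)%E.
Proof. by move=> mA; rewrite sigma_sphereE measure_ge0. Qed.

Lemma sigma_sphereI A : sigma (S `&` A) = sigma A.
Proof. by rewrite /sigma_sphere setIA setIid. Qed.

Lemma sigma_sphere_mulmx (M : 'M[R]_n) (A : set B) : M *m M^T = 1%:M -> measurable A ->
  sigma [set y : V | A (y *m M : B)] = sigma A.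
Proof.
move=> MM mA; rewrite /sigma_sphere !punctured_coneE.
have [b0|b0] := eqVneq b 0; first by rewrite b0 invr0 !mul0e.
have mC : measurable (@normalize R n @^-1` A `&` punctured_ball : set B).
  apply: measurableI; last exact: measurable_punctured_ball.
  by rewrite -[X in measurable X]setTI; exact: measurable_normalize.
have := lebesgue_rV_mulmx MM mC.
rewrite lebesgue_rV_sigma_finiteE; set C' := [set y | _]; set C := _ `&` _ => h.
rewrite (_ : _ `&` punctured_ball = C').
  have cancel x : (b^-1%:E * (b%:E * x) = x)%E.
    by rewrite muleA -EFinM mulVf// mul1e.
  by rewrite -[X in (_ * X)%E = _]cancel h cancel.
have M0 (y : V) : (y *m M == 0) = (y == 0) by rewrite -!enorm_eq0 enorm_mulmx.
rewrite /C'/C /punctured_ball /unit_ball /normalize.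
by apply/seteqP; split=> y; rewrite /= enorm_mulmx// M0 -scalemxAl.
Qed.

(** The translates of Z \cap ball by u / (k + 1) are pairwise disjoint, have equal measure and lie
    in one cube of finite measure, so that this common measure is 0. *)
Lemma lebesgue_rV_null_translates (Z : set B) (u : V) : measurable Z ->
  (forall x t, 0 < t -> Z x -> ~ Z (x + t *: u)) ->
  lam (Z `&` @unit_ball R n) = 0%E.
Proof.
move=> mZ Zu; set C := Z `&` _.
have mC : measurable C by apply: measurableI => //; exact: measurable_unit_ball.
pose T k : set B := [set y : V | C (y + (- (k.+1%:R^-1 *: u)))].
have mT k : measurable (T k).
  by rewrite -[X in measurable X]setTI; exact: measurable_addr_rV.
have lamT k : lam (T k) = lam C by exact: lebesgue_rV_translate.
have tT : trivIset setT T.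
  suff H i j y : (i < j)%N -> T i y -> T j y -> False.
    apply/trivIsetP => i j _ _; rewrite neq_ltn => /orP[ij|ij];
      rewrite -subset0 => y [Ti Tj]; [exact: (H i j y) | exact: (H j i y)].
  move=> ij [Ziy _] [Zjy _].
  apply: (Zu _ (i.+1%:R^-1 - j.+1%:R^-1) _ Ziy).
    by rewrite subr_gt0 ltf_pV2 ?posrE// ltr_nat ltnS.
  by rewrite scalerBl addrA subrK.
pose M := 1 + enorm u.
have TM k : T k `<=` rV_box M.
  move=> y [_ y1] i; apply: le_trans (coord_le_enorm _ _) _.
  have := enormD ((y : V) - k.+1%:R^-1 *: u) (k.+1%:R^-1 *: u).
  rewrite subrK enormZ gtr0_norm ?invr_gt0// => /le_trans; apply.
  rewrite lerD// ler_piMl ?enorm_ge0// invf_le1// ler1n//.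
have Cfin : lam C \is a fin_num.
  rewrite ge0_fin_numE//; apply: le_lt_trans lebesgue_unit_ball.
  by apply: le_measure; rewrite ?inE//; [exact: measurable_unit_ball | move=> x []].
have boxfin : lam (rV_box M) \is a fin_num.
  by rewrite ge0_fin_numE// lebesgue_rV_box.
have bound N : fine (lam C) *+ N <= fine (lam (rV_box M)).
  have mU : measurable (\big[setU/set0]_(i < N) T i).
    by apply: bigsetU_measurable.
  have : (lam (\big[setU/set0]_(i < N) T i) <= lam (rV_box M))%E.
    apply: le_measure; rewrite ?inE//; first exact: measurable_rV_box.
    by rewrite -bigcup_mkord; apply: bigcup_sub => i _; exact: TM.
  rewrite (measure_semi_additive_ord_I lam)//; last exact: sub_trivIset tT.
  rewrite (eq_bigr (fun=> (fine (lam C))%:E)); last by move=> i _; rewrite fineK//; exact: lamT.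
  by rewrite sumEFin -(fineK boxfin) lee_fin sumr_const card_ord.
rewrite -(fineK Cfin); congr (_%:E); apply/eqP; rewrite eq_le fine_ge0// andbT leNgt.
apply/negP => x0; set x := fine _ in bound x0.
have := bound (Num.trunc (fine (lam (rV_box M)) / x)).+1.
by apply/negP; rewrite -ltNge -mulr_natr mulrC -ltr_pdivrMr// truncnS_gt.
Qed.

(** For [Z] stable under positive scaling, the cone over its trace on the sphere lies in [Z] itself,
    and the argument on translates applies. *)
Lemma sigma_sphere_null (Z : set B) (u : V) : measurable Z ->
  (forall (x : V) t, 0 < t -> Z x -> Z (t *: x)) ->
  (forall x t, 0 < t -> Z x -> ~ Z (x + t *: u)) ->
  sigma Z = 0%E.
Proof.
move=> mZ Zcone Zu; rewrite /sigma_sphere punctured_coneE -lebesgue_rV_sigma_finiteE.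
rewrite [X in (_ * X)%E](_ : _ = 0%E) ?mule0//; apply/eqP.
rewrite eq_le measure_ge0 andbT -(lebesgue_rV_null_translates mZ Zu).
apply: le_measure; rewrite ?inE.
- apply: measurableI; last exact: measurable_punctured_ball.
  by rewrite -[X in measurable X]setTI; exact: measurable_normalize.
- by apply: measurableI => //; exact: measurable_unit_ball.
- move=> y [Zy [y1 y0]]; split=> //.
  have e0 : 0 < enorm (y : V) by rewrite enorm_gt0.
  by have := Zcone _ _ e0 Zy; rewrite /normalize scalerA divff ?scale1r// gt_eqF.
Qed.

Lemma measurable_orthogonal (u : V) : measurable ([set x : V | dot x u = 0] : set B).
Proof.
apply: closed_measurable_rV.
rewrite (_ : [set _ | _] = (fun x => dot x u) @^-1` [set 0])//.
by apply: preimage_closed; [move=> x _; exact: continuous_dotl | exact: closed_eq].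
Qed.

End SphericalMeasure.

(** * Convex cones and spherical bodies *)

Section Cones.
Variables (R : realType) (n : nat).
Local Notation V := 'rV[R]_n.
Local Notation S := (sphere R n).
Implicit Types (C D K L : set V) (x y z u v w : V) (t : R).

Lemma max_rank_rows D : exists k (A : 'M[R]_(k, n)),
  (forall i, D (row i A)) /\ forall x, D x -> (x <= A)%MS.
Proof.
(* [A] has maximal rank among the matrices with rows in [D]. *)
pose P r := `[< exists k (A : 'M[R]_(k, n)), (forall i, D (row i A)) /\ \rank A = r >].
have exP : exists r, P r.
  by exists (\rank (0 : 'M[R]_(0, n))); apply/asboolP; exists 0, 0; split=> // -[].
have Pn r : P r -> (r <= n)%N by move/asboolP => [k [A [_ <-]]]; exact: rank_leq_col.
have [r /asboolP[k [A [DA <-]]] rmax] := ex_maxnP exP Pn.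
exists k, A; split=> // x Dx.
have : P (\rank (col_mx A x)).
  apply/asboolP; exists (k + 1)%N, (col_mx A x); split=> // i.
  case: (split_ordP i) => j ->; rewrite ?rowKu ?rowKd//.
  by rewrite (_ : row j x = x)//; apply/rowP => l; rewrite mxE ord1.
move/rmax => rk; have /andP[_ le1] : (A == A + x)%MS.
  by rewrite -(mxrank_leqif_eq (addsmxSl A x)).2 eqn_leq mxrankS ?addsmxSl//= addsmxE.
exact: submx_trans (addsmxSr A x) le1.
Qed.

Lemma convex_coneD C x y : closed_convex_cone C -> C x -> C y -> C (x + y).
Proof.
move=> [_ cvxC _ scC] Cx Cy.
have h0 : (0 : R) <= 2^-1 by rewrite invr_ge0.
have h1 : (2^-1 : R) <= 1 by rewrite invf_le1// ler1n.
have := cvxC x y (Itv01 h0 h1); rewrite !inE => /(_ Cx Cy) C2.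
have -> : x + y = 2 *: (conv (Itv01 h0 h1) (x : convex_lmodType V) y : V).
  rewrite /conv/= scalerDr !scalerA divff// scale1r.
  by rewrite [2 * _](_ : _ = 1) ?scale1r//; rewrite /onem; lra.
exact: scC.
Qed.

Lemma closed_convex_coneP C : closed C -> C 0 ->
  (forall x y, C x -> C y -> C (x + y)) ->
  (forall t x, 0 <= t -> C x -> C (t *: x)) -> closed_convex_cone C.
Proof.
move=> clC C0 CD CZ; split=> // x y t; rewrite !inE => Cx Cy.
by apply: CD; apply: CZ => //; rewrite subr_ge0.
Qed.

(** Such a cone is stable under all linear combinations, so it equals the span of a finite family of
    its own elements. *)
Lemma opp_closed_cone_linear C : closed_convex_cone C ->
  (forall x, C x -> C (- x)) -> linear_subspace C.
Proof.
move=> coneC CN; have [k [A [CA maxA]]] := max_rank_rows C.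
have CD x y : C x -> C y -> C (x + y) by exact: convex_coneD.
have CZ t x : C x -> C (t *: x).
  have [_ _ _ CZ0] := coneC; move=> Cx; have [t0|t0] := leP 0 t; first exact: CZ0.
  rewrite -(opprK (t *: x)) -scaleNr; apply: CN; apply: CZ0 => //.
  by rewrite oppr_ge0 ltW.
have Csum (u : 'I_k -> R) : C (\sum_i u i *: row i A).
  elim/big_ind : _ => [||i _]; [by case: coneC | exact: CD | exact: CZ].
exists (\sum_i <[row i A]>)%VS; apply/seteqP; split=> x /=.
  move=> /maxA/submxP[u ->]; rewrite mulmx_sum_row.
  by apply: memv_sumr => i _; rewrite memvZ// memv_line.
move=> /memv_sumP[v vP ->].
elim/big_ind : _ => [||i _]; [by case: coneC | exact: CD |].
by have /vlineP[c ->] := vP i isT; exact: CZ.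
Qed.

(* [w] is the difference between [- x] and its projection on the cone, up to sign. *)
Lemma cone_pole C : closed_convex_cone C -> ~ linear_subspace C ->
  exists w, [/\ C w, w != 0 & forall y, C y -> 0 <= dot w y].
Proof.
move=> coneC nlin; have [clC _ C0 CZ] := coneC.
have [x Cx CNx] : exists2 x, C x & ~ C (- x).
  apply: contrapT => h; apply: nlin; apply: opp_closed_cone_linear => // x Cx.
  by apply: contrapT => CNx; apply: h; exists x.
(* Only c with |x + c| <= |x| compete with c = 0; this makes the minimization compact. *)
pose E : set V := C `&` [set c | enorm (x + c) <= enorm x].
have E0 : E 0 by split=> //=; rewrite addr0.
have cf : continuous (fun c => enorm (x + c)).
  move=> c; apply: (@continuous_comp V V R (fun c => x + c) (@enorm R n)).
    by apply: (@continuousD R V V (cst x) id); [exact: cst_continuous | exact: cvg_id].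
  exact: continuous_enorm.
have cE : compact E.
  apply: bounded_closed_compact; last first.
    apply: closedI => //.
    apply: (@preimage_closed _ _ (fun c => enorm (x + c)) [set t | t <= enorm x]).
      by move=> c _; exact: cf.
    exact: closed_le.
  exists (enorm x + enorm x); split => [|M M1 c [_ cx]]; first exact: num_real.
  change (mx_norm c <= M).
  rewrite mx_normrE; apply/bigmax_leP; split.
    by apply: ltW; apply: le_lt_trans M1; rewrite addr_ge0 ?enorm_ge0.
  move=> [i j] _ /=; rewrite ord1; apply: le_trans (coord_le_enorm _ _) _.
  apply: ltW; apply: le_lt_trans M1; rewrite -[c](addKr x).
  by apply: le_trans (enormD _ _) _; rewrite enormN lerD2l.
have [p] := compact_EVT_min (ex_intro E 0 E0) cE (continuous_subspaceT cf).
rewrite inE => -[Cp px] pmin.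
have pmin' c : C c -> enorm (x + p) <= enorm (x + c).
  move=> Cc; have [cx|/ltW] := leP (enorm (x + c)) (enorm x); last exact: le_trans.
  by apply: pmin; rewrite inE.
exists (x + p); split; first exact: convex_coneD.
  by apply: contra_not_neq CNx => xp0; rewrite -[- x]addr0 -xp0 addKr.
move=> y Cy; rewrite leNgt; apply/negP => wy.
have yy : 0 < dot y y.
  rewrite lt_def dotxx_ge0 andbT dotxx_eq0; apply: contraTneq wy => ->.
  by rewrite dot0r ltxx.
(* The minimizer of the quadratic s |-> |x + p + s y|^2; if <x + p, y> < 0 it is positive and
   contradicts the choice of [p]. *)
pose t := - dot (x + p) y / dot y y.
have t0 : 0 <= t by rewrite divr_ge0// ?oppr_ge0 ltW.
have := pmin' (p + t *: y) (convex_coneD coneC Cp (CZ _ _ t0 Cy)).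
rewrite -(@ler_sqr R) ?nnegrE ?enorm_ge0// !sqr_enorm addrA.
rewrite [dot (_ + t *: y) _]dotDl !(dotDr _ (t *: y)) !dotZl !dotZr (dotC y (x + p)).
have -> : t * dot y y = - dot (x + p) y by rewrite divfK// gt_eqF.
have tp : 0 < t by rewrite divr_gt0// oppr_gt0.
by nra.
Qed.

(** With its converse [spherical_body_of_pole], this trades the negative condition of not being a
    subspace for a witness inside the body, which passes to limits and rotations. *)
Lemma spherical_body_pole K : spherical_body K ->
  exists2 w, K w & forall y, K y -> 0 <= dot w y.
Proof.
move=> [C [coneC nlin ->]]; have [w [Cw w0 wC]] := cone_pole coneC nlin.
have [_ _ _ CZ] := coneC.
exists (normalize w) => [|y [_ Cy]].
  by split; [exact: normalize_sphere | apply: CZ; rewrite ?invr_ge0 ?enorm_ge0].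
by rewrite dotZl mulr_ge0 ?wC ?invr_ge0 ?enorm_ge0.
Qed.

Lemma spherical_body_of_pole C w : closed_convex_cone C -> C w -> w != 0 ->
  (forall y, C y -> 0 <= dot w y) -> spherical_body (S `&` C).
Proof.
move=> coneC Cw w0 wC; exists C; split=> // -[U CU].
have : C (- w) by rewrite CU/= memvN; move: Cw; rewrite CU.
move/wC; rewrite dotNr leNgt oppr_lt0 => /negP; apply.
by rewrite lt_def dotxx_eq0 w0 dotxx_ge0.
Qed.

Lemma spherical_body_sub K : spherical_body K -> K `<=` S.
Proof. by move=> [C [_ _ ->]] x []. Qed.

Lemma spherical_body_closed K : spherical_body K -> closed K.
Proof. by move=> [C [[? _ _ _] _ ->]]; apply: closedI => //; exact: closed_sphere. Qed.

Lemma spherical_body_compact K : spherical_body K -> compact K.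
Proof.
move=> bK; apply: subclosed_compact (spherical_body_closed bK) (@compact_sphere R n) _.
exact: spherical_body_sub.
Qed.

Lemma spherical_body_conic K u v (a b : R) : spherical_body K -> K u -> K v ->
  0 <= a -> 0 <= b -> a *: u + b *: v != 0 -> K (normalize (a *: u + b *: v)).
Proof.
move=> [C [coneC _ ->]] [_ Cu] [_ Cv] a0 b0 uv0; split; first exact: normalize_sphere.
have [_ _ _ CZ] := coneC; apply: (CZ); first by rewrite invr_ge0 enorm_ge0.
by apply: convex_coneD => //; apply: CZ.
Qed.

End Cones.

(** * The hitting functional *)

Section Crossing.
Variables (R : realType) (n : nat).
Local Notation V := 'rV[R]_n.
Local Notation B := (borel_rV R n).
Local Notation S := (sphere R n).
Local Notation sigma := (@sigma_sphere R n).
Implicit Types (K L : set V) (x y z u v w : V) (t e : R).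

Definition hitting K : set V := [set x : V | hyperplane x `&` K !=set0].

Definition crossing K e : set V :=
  [set x | (exists2 u, K u & e < dot x u) /\ (exists2 v, K v & dot x v < - e)].

(** The inner normals of the hyperplanes supporting [K]: up to sign, what [hitting K] has beyond
    [crossing K 0]. *)
Definition touching K : set V :=
  [set x | (forall y, K y -> 0 <= dot x y) /\ (exists2 y, K y & dot x y = 0)].

Lemma open_dot_gt (c : R) y : open [set x : V | c < dot x y].
Proof.
apply: (@open_comp V R (fun x => dot x y) [set t | c < t]); last exact: open_gt.
by move=> x _; exact: continuous_dotl.
Qed.

Lemma open_dot_lt (c : R) y : open [set x : V | dot x y < c].
Proof.
apply: (@open_comp V R (fun x => dot x y) [set t | t < c]); last exact: open_lt.
by move=> x _; exact: continuous_dotl.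
Qed.

Lemma closed_dot_ge (c : R) y : closed [set x : V | c <= dot x y].
Proof.
rewrite (_ : [set _ | _] = ~` [set x : V | dot x y < c]).
  by apply: open_closedC; exact: open_dot_lt.
by apply/seteqP; split=> x /=; rewrite leNgt => /negP.
Qed.

Lemma open_crossing K e : open (crossing K e).
Proof.
rewrite (_ : crossing K e = (\bigcup_(u in K) [set x : V | e < dot x u]) `&`
    (\bigcup_(v in K) [set x : V | dot x v < - e])).
  by apply: openI; apply: bigcup_open => u _; [exact: open_dot_gt | exact: open_dot_lt].
by apply/seteqP; split=> x [[u Ku xu] [v Kv xv]]; split;
  by [exists u | exists v | exists u | exists v].
Qed.

Lemma measurable_crossing K e : measurable (crossing K e : set B).
Proof. by apply: open_measurable_rV; exact: open_crossing. Qed.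

(** If x^perp misses [K], then |<x, .>| has a positive minimum on [K], and moving x by less than
    this minimum divided by a bound of [K] creates no zero. *)
Lemma closed_hitting K : compact K -> closed (hitting K).
Proof.
move=> cK; rewrite -openC openE => x xK; rewrite /interior.
have [->|/set0P K0] := eqVneq K set0.
  by apply: filterE => y [z []].
have cdot : {within K, continuous (fun y => `|dot x y|)}.
  apply: continuous_subspaceT => y.
  apply: (@continuous_comp V R R (dot x) Num.norm); first exact: continuous_dotr.
  exact: norm_continuous.
have [c] := compact_EVT_min K0 cK cdot; rewrite inE => Kc cmin.
have c0 : 0 < `|dot x c|.
  by rewrite normr_gt0; apply/eqP => xc; apply: xK; exists c.
have [M /= M0 KM] : exists2 M, 0 < M & forall y, K y -> enorm y <= M.
  have [c'] := @compact_EVT_max V R (@enorm R n) K K0 cK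
    (continuous_subspaceT (@continuous_enorm R n)).
  rewrite inE => Kc' c'max; exists (1 + enorm c').
    by rewrite ltr_pwDl// enorm_ge0.
  by move=> y Ky; rewrite (le_trans (c'max y _)) ?inE// lerDr.
have := @enorm_ball R n x (`|dot x c| / M) (divr_gt0 c0 M0).
apply: filterS => y /= xy [z [yz Kz]].
have := cmin z; rewrite inE => /(_ Kz).
have -> : dot x z = dot (x - y) z by rewrite dotBl yz subr0.
apply/negP; rewrite -ltNge; apply: le_lt_trans (dot_le_enorm _ _) _.
move: xy; rewrite ltr_pdivlMr//; apply: le_lt_trans.
by rewrite ler_wpM2l ?enorm_ge0 ?KM.
Qed.

Lemma measurable_hitting K : compact K -> measurable (hitting K : set B).
Proof. by move=> cK; apply: closed_measurable_rV; exact: closed_hitting. Qed.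

Lemma hitting_functionalE K : compact K ->
  hitting_functional K = fine (sigma (hitting K)).
Proof.
move=> cK; rewrite /hitting_functional /U1 mulrA divff// mul1r; congr fine.
have mS : measurable (S : set B) by apply: closed_measurable_rV; exact: closed_sphere.
rewrite -sigma_sphereI setIC sigma_sphereE.
by rewrite integral_indic//; exact: measurable_hitting.
Qed.

Lemma closed_touching K : compact K -> closed (touching K).
Proof.
move=> cK; rewrite (_ : touching K =
    (\bigcap_(y in K) [set x : V | 0 <= dot x y]) `&` hitting K).
  apply: closedI; last exact: closed_hitting.
  by apply: closed_bigI => y _; exact: closed_dot_ge.
apply/seteqP; split=> x; first by move=> [h [y Ky xy]]; split=> //; exists y.
by move=> [h [y [xy Ky]]]; split=> //; exists y.
Qed.

Lemma sigma_hyperplane u : u != 0 -> sigma [set x : V | dot x u = 0] = 0%E.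
Proof.
move=> u0; apply: (@sigma_sphere_null _ _ _ u).
- exact: measurable_orthogonal.
- by move=> x t t0 /= xu; rewrite dotZl xu mulr0.
- move=> x t t0 /= xu; rewrite dotDl xu add0r dotZl => /eqP.
  by rewrite mulf_eq0 gt_eqF//= dotxx_eq0 (negPf u0).
Qed.

(* The nonnegative dual of [K] either lies in a hyperplane or contains a point
   that is positive on [K \ {0}]; in both cases a translation argument applies. *)
Lemma sigma_touching K : compact K -> K `<=` S -> sigma (touching K) = 0%E.
Proof.
move=> cK KS; pose D := [set x : V | forall y, K y -> 0 <= dot x y].
have mT : measurable (touching K : set B).
  by apply: closed_measurable_rV; exact: closed_touching.
have [k [A [DA maxA]]] := max_rank_rows D.
have [fullA|nfull] := boolP (row_full A); last first.
  (* [D] spans a proper subspace; a nonzero vector from the column space of the cokernel of [A] is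
     orthogonal to it. *)
  have [l l0 Al] : exists2 l : V, l != 0 & forall x, D x -> dot x l = 0.
    move: nfull; rewrite -cokermx_eq0 -trmx_eq0 => /rowV0Pn[l /submxP[v lE] l0].
    exists l => // x /maxA/submxP[w ->].
    by rewrite /dot lE trmx_mul trmxK -mulmxA (mulmxA A) mulmx_coker mul0mx mulmx0 mxE.
  apply/eqP; rewrite eq_le; apply/andP; split; last exact: sigma_sphere_ge0.
  rewrite -(sigma_hyperplane l0); apply: sigma_sphere_le => //.
    exact: measurable_orthogonal.
  by move=> x [Dx _]; exact: Al.
pose u := \sum_i row i A.
apply: (@sigma_sphere_null _ _ _ u) => //.
  move=> x t t0 [Dx [y Ky xy]]; split.
    by move=> z Kz; rewrite dotZl mulr_ge0 ?Dx// ltW.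
  by exists y => //; rewrite dotZl xy mulr0.
move=> x t t0 [Dx _] [_ [y Ky]]; rewrite dotDl dotZl => xtu.
have rowy i : 0 <= dot (row i A) y by exact: DA.
have uE : dot u y = \sum_i dot (row i A) y.
  by rewrite /u; elim/big_rec2 : _ => [|i a b _ <-]; rewrite ?dot0l ?dotDl.
have uy0 : 0 <= dot u y by rewrite uE sumr_ge0.
(* At the contact point y of x + t u both <x, y> and t <u, y> are nonnegative with sum 0. Then every
   row of [A] is orthogonal to y, and full rank forces y = 0, which is not on the sphere. *)
have /eqP : dot u y = 0 by have := Dx _ Ky; nra.
rewrite uE psumr_eq0// => /allP rows0.
have /eqP := sphere_neq0 (KS _ Ky); apply.
apply: trmx_inj; rewrite trmx0.
have [A' A'A] : exists A', A' *m A = 1%:M.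
  by exists (pinvmx A); have := mulVpmx fullA.
rewrite -[y^T]mul1mx -A'A -mulmxA; apply/colP => j; rewrite mxE big1 ?mxE// => i _.
have := rows0 i (mem_index_enum i); rewrite /dot => /eqP.
by rewrite -row_mul mxE => ->; rewrite mulr0.
Qed.

(** The combination - <x, v> u + <x, u> v is orthogonal to x and, normalized, lies in [K]. It
    vanishes only if u and v are antipodal; then one goes through a pole of [K]. *)
Lemma crossing_hitting K e : spherical_body K -> 0 <= e -> crossing K e `<=` hitting K.
Proof.
move=> bK e0 x [[u Ku xu] [v Kv xv]].
have KS := spherical_body_sub bK.
have [w Kw wK] := spherical_body_pole bK.
have H u' v' : K u' -> K v' -> 0 < dot x u' -> dot x v' < 0 ->
    - dot x v' *: u' + dot x u' *: v' != 0 -> hitting K x.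
  move=> Ku' Kv' xu' xv' h.
  exists (normalize (- dot x v' *: u' + dot x u' *: v')); split.
    rewrite /hyperplane/= dotZr dotDr !dotZr.
    by rewrite [X in _ * X](_ : _ = 0) ?mulr0//; ring.
  by apply: spherical_body_conic => //; [rewrite oppr_ge0|]; exact: ltW.
have {}xu : 0 < dot x u by lra.
have {}xv : dot x v < 0 by lra.
have [uv|uv] := eqVneq (- dot x v *: u + dot x u *: v) 0; last exact: (H u v).
(* Here u and v are antipodal, hence orthogonal to w. *)
have wu : dot w u = 0.
  have : dot w (- dot x v *: u + dot x u *: v) = 0 by rewrite uv dot0r.
  rewrite dotDr !dotZr => h; have wu := wK _ Ku; have wv := wK _ Kv.
  by apply/eqP; rewrite eq_le wu andbT leNgt; apply/negP => wu0; nra.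
have wv : dot w v = 0.
  have : dot w (- dot x v *: u + dot x u *: v) = 0 by rewrite uv dot0r.
  rewrite dotDr !dotZr wu mulr0 add0r => /eqP.
  by rewrite mulf_eq0 gt_eqF// => /eqP.
have ww := sphere_dot (KS _ Kw).
have [xw|xw|xw] := ltgtP (dot x w) 0; last by exists w.
- apply: (H u w) => //; apply/eqP => /(congr1 (dot w)).
  by rewrite dotDr !dotZr dot0r wu ww mulr0 add0r mulr1 => xu0; rewrite xu0 ltxx in xu.
- apply: (H w v) => //; apply/eqP => /(congr1 (dot w)).
  rewrite dotDr !dotZr dot0r wv ww mulr0 addr0 mulr1 => /eqP.
  by rewrite oppr_eq0 lt_eqF.
Qed.

Lemma hitting_subset K : hitting K `<=`
  crossing K 0 `|` (touching K `|` touching [set - y | y in K]).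
Proof.
move=> x [y [xy Ky]].
have [[u Ku xu]|h] := pselect (exists2 u, K u & 0 < dot x u); last first.
  right; right; split=> [_ [z Kz <-]|]; last first.
    by exists (- y); [exists y | rewrite dotNr xy oppr0].
  by rewrite dotNr oppr_ge0 leNgt; apply/negP => xz; apply: h; exists z.
have [[v Kv xv]|h] := pselect (exists2 u, K u & dot x u < 0); last first.
  right; left; split=> [z Kz|]; last by exists y.
  by rewrite leNgt; apply/negP => xz; apply: h; exists z.
by left; split; [exists u | exists v; rewrite ?oppr0].
Qed.

Lemma crossing_le K e e' : e <= e' -> crossing K e' `<=` crossing K e.
Proof.
by move=> ee x [[u Ku xu] [v Kv xv]]; split; [exists u | exists v] => //; lra.
Qed.

(** For x on the sphere <x, .> is 1-Lipschitz, so the loss of margin e - e' pays for the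
    displacement from [K] to [L]. *)
Lemma crossing_near K L e e' :
  (forall y, K y -> exists2 z, L z & enorm (y - z) <= e - e') ->
  S `&` crossing K e `<=` crossing L e'.
Proof.
move=> KL x [Sx [[u Ku xu] [v Kv xv]]].
have H y z : enorm (y - z) <= e - e' -> `|dot x y - dot x z| <= e - e'.
  rewrite -dotBr; apply: le_trans; apply: le_trans (dot_le_enorm _ _) _.
  by rewrite Sx mul1r.
have [u' Lu' /H] := KL u Ku; have [v' Lv' /H] := KL v Kv.
rewrite !ler_norml => /andP[h2 _] /andP[_ h1].
by split; [exists u' | exists v'] => //; lra.
Qed.

Lemma sigma_hitting_crossing K : spherical_body K ->
  sigma (hitting K) = sigma (crossing K 0).
Proof.
move=> bK; have cK := spherical_body_compact bK; have KS := spherical_body_sub bK.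
have cN : compact [set - y | y in K].
  apply: continuous_compact => //; apply: continuous_subspaceT => y.
  by apply: (@continuousN R V V id); exact: cvg_id.
have NS : [set - y | y in K] `<=` S by move=> _ [y Ky <-]; exact/sphereN/KS.
have mT := closed_measurable_rV (closed_touching cK).
have mN := closed_measurable_rV (closed_touching cN).
have mC := measurable_crossing K 0.
have mH := measurable_hitting cK.
apply/eqP; rewrite eq_le; apply/andP; split; last first.
  by apply: sigma_sphere_le => //; exact: crossing_hitting.
have mTN := measurableU _ _ mT mN.
apply: le_trans (sigma_sphere_le mH (measurableU _ _ mC mTN) (@hitting_subset K)) _.
apply: le_trans (sigma_sphereU_le mC mTN) _.
rewrite -[leRHS]adde0 leeD2l//; apply: le_trans (sigma_sphereU_le mT mN) _.
by rewrite !sigma_touching// adde0.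
Qed.

(** Continuity from below along the margins 1 / (k + 1), whose crossing sets increase to
    [crossing K 0]; the latter has the full measure of [hitting K]. *)
Lemma sigma_crossing_cvg K (c : R) : spherical_body K ->
  c < hitting_functional K ->
  exists2 e, 0 < e & c < fine (sigma (crossing K e)).
Proof.
move=> bK; rewrite hitting_functionalE; last exact: spherical_body_compact.
rewrite sigma_hitting_crossing// => cK.
pose F (k : nat) : set B := crossing K k.+1%:R^-1.
have FE : crossing K 0 = \bigcup_k F k.
  apply/seteqP; split=> [x [[u Ku xu] [v Kv xv]]|x [k _]]; last exact: crossing_le.
  have m0 : 0 < Num.min (dot x u) (- dot x v) by rewrite lt_min xu; lra.
  have [k] : exists k : nat, k.+1%:R^-1 < Num.min (dot x u) (- dot x v).
    exists (Num.trunc (Num.min (dot x u) (- dot x v))^-1).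
    by rewrite invf_plt ?posrE// truncnS_gt.
  rewrite lt_min => /andP[h1 h2]; exists k => //; split; [exists u => // | exists v => //].
  by rewrite ltrNr.
have mF k : measurable (F k) by exact: measurable_crossing.
have mU : measurable (\bigcup_k F k) by exact: bigcup_measurable.
have ndF : {homo F : k m / (k <= m)%N >-> (k <= m)%O}.
  move=> k m km; apply/subsetPset; apply: crossing_le.
  by rewrite lef_pV2 ?posrE// ler_nat.
have := @nondecreasing_cvg_mu _ _ _ (@sigma_measure R n) F mF mU ndF.
rewrite -sigma_sphereE -FE => Fcvg.
have nb : nbhs (sigma (crossing K 0)) [set y | (c%:E < y)%E].
  apply: open_nbhs_nbhs; split; first exact: open_ereal_gt_ereal.
  by rewrite /= -(fineK (sigma_sphere_fin_num (measurable_crossing K 0))) lte_fin.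
have [k _ /(_ k (leqnn k))] := Fcvg _ nb.
rewrite /= -(fineK (sigma_sphere_fin_num (mF k))) lte_fin.
by exists k.+1%:R^-1 => //; rewrite invr_gt0.
Qed.

End Crossing.

(** * Hausdorff distance and compactness *)

Section Hausdorff.
Variables (R : realType) (n : nat).
Local Notation V := 'rV[R]_n.
Local Notation S := (sphere R n).
Implicit Types (K L : set V) (x y z u v w : V) (t e : R).

(** Hausdorff closeness with explicit witnesses and in the ambient distance, free of suprema and arc
    cosines; [shausdorff_lt] links it to [shausdorff]. *)
Definition euclid_close e K L : Prop :=
  (forall x, K x -> exists2 y, L y & enorm (x - y) <= e) /\
  (forall y, L y -> exists2 x, K x & enorm (y - x) <= e).

Lemma euclid_close_sym e K L : euclid_close e K L -> euclid_close e L K.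
Proof. by case. Qed.

Lemma dot_sphere_itv x y : S x -> S y -> -1 <= dot x y <= 1.
Proof. by move=> Sx Sy; rewrite -ler_norml (le_trans (dot_le_enorm _ _))// Sx Sy mulr1. Qed.

Lemma sdist_le x y (a : R) : S x -> S y -> 0 <= a <= pi -> cos a <= dot x y ->
  sdist x y <= a.
Proof.
move=> Sx Sy a0pi h; rewrite leNgt; apply/negP; rewrite /sdist => asd.
have xy := dot_sphere_itv Sx Sy.
have aI : acos (dot x y) \in `[0, pi] by rewrite in_itv/= acos_ge0//= acos_lepi.
have := ltr_cos a0pi aI.
by rewrite [RHS]asd acosK ?in_itv//= ltNge h.
Qed.

Lemma sdist_ge0 x y : S x -> S y -> 0 <= sdist x y.
Proof. by move=> Sx Sy; rewrite acos_ge0// dot_sphere_itv. Qed.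

Lemma sup_inf_sdist_le (a : R) K L : K !=set0 -> K `<=` S -> L `<=` S ->
  (forall x, K x -> exists2 y, L y & sdist x y <= a) ->
  sup [set inf [set sdist x y | y in L] | x in K] <= a.
Proof.
move=> [x0 Kx0] KS LS KL; apply: ge_sup; first by exists (inf [set sdist x0 y | y in L]), x0.
move=> _ [x Kx <-]; have [y Ly xy] := KL x Kx; apply: le_trans xy.
by apply: ge_inf; [exists 0 => _ [z Lz <-]; apply: sdist_ge0; [exact: KS | exact: LS] | exists y].
Qed.

Lemma shausdorff_lt (delta : R) : 0 < delta ->
  exists2 e, 0 < e & forall K L, K !=set0 -> L !=set0 -> K `<=` S -> L `<=` S ->
    euclid_close e K L -> shausdorff K L < delta.
Proof.
move=> d0; pose a := Num.min (delta / 2) pi.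
have a0 : 0 < a by rewrite lt_min pi_gt0 divr_gt0.
have aI : 0 <= a <= pi by rewrite (ltW a0) ge_min lexx orbT.
have ad : a < delta by rewrite gt_min; apply/orP; left; lra.
have cosa : cos a < 1.
  have := @ltr_cos R 0 a; rewrite cos0 !in_itv/= lexx pi_ge0 => /(_ isT aI) ->.
  exact: a0.
(* On the sphere <x, y> >= 1 - |x - y|, so |x - y| <= 1 - cos a gives <x, y> >= cos a, that is, an
   angle at most a. Capping a at pi keeps it in the range of [acos]. *)
exists (1 - cos a); first by rewrite subr_gt0.
have cosa1 := cos_geN1 a.
have near x y : S x -> S y -> enorm (x - y) <= 1 - cos a -> sdist x y <= a.
  move=> Sx Sy xy; apply: sdist_le => //.
  have := dot_le_enorm x (y - x); rewrite dotBr sphere_dot// Sx mul1r ler_norml enormB.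
  by move=> /andP[h _]; lra.
move=> K L K0 L0 KS LS [KL LK]; apply: le_lt_trans ad; rewrite ge_max; apply/andP; split.
  apply: sup_inf_sdist_le => // x Kx; have [y Ly xy] := KL x Kx.
  by exists y => //; apply: near => //; [exact: KS | exact: LS].
rewrite (_ : [set _ | _ in L] = [set inf [set sdist y x | x in K] | y in L]).
  apply: sup_inf_sdist_le => // y Ly; have [x Kx xy] := LK y Ly.
  by exists x => //; apply: near => //; [exact: LS | exact: KS].
have E y : [set sdist x y | x in K] = [set sdist y x | x in K].
  by apply/seteqP; split=> r [x Kx <-]; exists x => //; rewrite /sdist dotC.
by apply/seteqP; split=> r [y Ly <-]; exists y => //; rewrite E.
Qed.

Lemma body_continuous_close (Sigma : set V -> R) K (eps : R) :
  body_continuous Sigma -> spherical_body K -> 0 < eps ->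
  exists2 e, 0 < e & forall L, spherical_body L -> euclid_close e K L ->
    `|Sigma L - Sigma K| < eps.
Proof.
move=> cS bK eps0; have [delta d0 Sd] := cS K bK eps eps0.
have [e e0 He] := shausdorff_lt d0; exists e => // L bL KL; apply: Sd => //.
have ne M : spherical_body M -> M !=set0.
  by move=> /spherical_body_pole[w Mw _]; exists w.
by apply: He => //; [exact: ne | exact: ne | exact: spherical_body_sub | exact: spherical_body_sub].
Qed.

(** Normalizing moves x by the difference between |x| and 1 = |v|, at most |x - v|; the triangle
    inequality adds the second |x - v|. *)
Lemma normalize_near x v : S v -> x != 0 -> enorm (normalize x - v) <= 2 * enorm (x - v).
Proof.
move=> Sv x0; have ex : 0 < enorm x by rewrite enorm_gt0.
have h1 : enorm (normalize x - x) <= enorm (x - v).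
  rewrite /normalize (_ : _ *: x - x = ((enorm x)^-1 - 1) *: x); last by rewrite scalerBl scale1r.
  rewrite enormZ -[X in _ * X](gtr0_norm ex) -normrM mulrBl mulVf ?gt_eqF// mul1r ler_norml.
  have := enormD (x - v) v; have := enormD (v - x) x; rewrite !subrK Sv (enormB v).
  by move=> h h'; apply/andP; split; lra.
by have := enorm_sub_le (normalize x) x v; lra.
Qed.

(* Ultrafilter form of Blaschke's selection theorem. *)
Lemma spherical_body_cluster (K_ : nat -> set V) : (forall m, spherical_body (K_ m)) ->
  exists2 K, spherical_body K &
    forall e N, 0 < e -> exists2 m, (N <= m)%N & euclid_close e (K_ m) K.
Proof.
(* Along an ultrafilter finer than [\oo] every sequence on the sphere converges, and every property
   of m or its negation holds on a set of [G]; no subsequences have to be extracted. *)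
move=> bK; have [G [UG ooG]] := @ultraFilterLemma nat \oo _.
have FG : ProperFilter G := ultra_proper.
have limS (y_ : nat -> V) : (forall m, S (y_ m)) ->
    exists2 y, S y & forall e, 0 < e -> G [set m | enorm (y - y_ m) < e].
  move=> Sy; have GS : (y_ @ G) S by exact: (@filterE _ G _ (y_ @^-1` S) Sy).
  have [y [Sy' cly]] := @compact_sphere R n (y_ @ G) _ GS; exists y => // e e0.
  have [//|Gc] := in_ultra_setVsetC [set m | enorm (y - y_ m) < e] UG.
  have := cly [set z | ~ enorm (y - z) < e] _ Gc (enorm_ball y e0).
  by move=> [z []].
have [C_ C_P] := choice bK.
have coneC m : closed_convex_cone (C_ m) by case: (C_P m).
have KE m : K_ m = S `&` C_ m by case: (C_P m).
have /choice[w_ w_P] : forall m, exists w, K_ m w /\ forall y, K_ m y -> 0 <= dot w y.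
  by move=> m; have [w Kw wK] := spherical_body_pole (bK m); exists w.
(* The lower limit of the cones [C_ m] along [G]. *)
pose C : set V := [set v | forall e, 0 < e -> G [set m | exists2 c, C_ m c & enorm (v - c) < e]].
have Ccone : closed_convex_cone C.
  apply: closed_convex_coneP.
  - move=> v clv e e0.
    have [u [Cu /= uv]] := clv _ (enorm_ball v (divr_gt0 e0 (ltr0n _ 2))).
    have := Cu _ (divr_gt0 e0 (ltr0n _ 2)); apply: filterS => m [c Cc uc].
    by exists c => //; have := enorm_sub_le v u c; lra.
  - by move=> e e0; apply: filterE => m; exists 0; [by case: (coneC m) | rewrite subrr enorm0].
  - move=> x y Cx Cy e e0; have e2 : 0 < e / 2 by rewrite divr_gt0.
    apply: filterS2 (Cx _ e2) (Cy _ e2) => m [c Cc xc] [c' Cc' yc].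
    exists (c + c'); first exact: convex_coneD.
    by rewrite opprD addrACA; have := enormD (x - c) (y - c'); lra.
  - move=> t x t0 Cx e e0.
    have t1 : 0 < e / (1 + t) by rewrite divr_gt0// ltr_pwDl.
    apply: filterS (Cx _ t1) => m [c Cc xc]; exists (t *: c).
      by have [_ _ _] := coneC m; apply.
    rewrite -scalerBr enormZ ger0_norm//.
    move: xc; rewrite ltr_pdivlMr; last by rewrite ltr_pwDl.
    by have := enorm_ge0 (x - c); nra.
have [w Sw wlim] := limS w_ (fun m => spherical_body_sub (bK m) (w_P m).1).
have w0 := sphere_neq0 Sw.
have C_w m : C_ m (w_ m) by have := (w_P m).1; rewrite KE => -[].
have Cw : C w.
  by move=> e e0; apply: filterS (wlim e e0) => m wm; exists (w_ m).
have C_dot m y : C_ m y -> 0 <= dot (w_ m) y.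
  move=> Cy; have [->|y0] := eqVneq y 0; first by rewrite dot0r.
  have Ky : K_ m (normalize y).
    rewrite KE; split; first exact: normalize_sphere.
    by have [_ _ _ CZ] := coneC m; apply: CZ => //; rewrite invr_ge0 enorm_ge0.
  have := (w_P m).2 _ Ky; rewrite dotZr pmulr_rge0// invr_gt0.
  by rewrite enorm_gt0.
have wC y : C y -> 0 <= dot w y.
  move=> Cy; rewrite leNgt; apply/negP => wy.
  (* Since <w_m, c> >= 0, replacing w by w_m and y by c within e gives <w, y> > - e (1 + |y|), while
     e (2 + |y|) = - <w, y>. *)
  pose e := - dot w y / (2 + enorm y).
  have y2 : 0 < 2 + enorm y by rewrite ltr_pwDl// enorm_ge0.
  have e0 : 0 < e by rewrite divr_gt0// oppr_gt0.
  have [m [wm [c Cc yc]]] := filter_ex (filterI (wlim e e0) (Cy e e0)).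
  have h1 := C_dot m c Cc.
  have h2 := dot_le_enorm (w - w_ m) y; have h3 := dot_le_enorm (w_ m) (y - c).
  have Swm : enorm (w_ m) = 1 by exact: spherical_body_sub (bK m) _ (w_P m).1.
  move: h2 h3; rewrite Swm mul1r dotBl dotBr !ler_norml => /andP[h2 _] /andP[h3 _].
  have h4 : enorm (w - w_ m) * enorm y <= e * enorm y.
    by rewrite ler_wpM2r ?enorm_ge0// ltW.
  have : e * (2 + enorm y) = - dot w y by rewrite /e divfK// gt_eqF.
  by move: wm yc => /= wm yc; nra.
pose K := S `&` C.
have bodyK : spherical_body K by exact: spherical_body_of_pole wC.
have limK y e : K y -> 0 < e -> G [set m | exists2 z, K_ m z & enorm (y - z) < e].
  move=> [Sy Cy] e0; have e2 : 0 < Num.min 1 (e / 2) by rewrite lt_min ltr01 divr_gt0.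
  apply: filterS (Cy _ e2) => m [c Cc]; rewrite lt_min => /andP[yc1 yc2].
  have c0 : c != 0.
    by apply: contraTneq yc1 => ->; rewrite subr0 Sy ltxx.
  exists (normalize c).
    rewrite KE; split; first exact: normalize_sphere.
    by have [_ _ _ CZ] := coneC m; apply: CZ => //; rewrite invr_ge0 enorm_ge0.
  by rewrite enormB; have := normalize_near Sy c0; rewrite (enormB c); lra.
have Klim y : S y -> (forall e, 0 < e -> G [set m | exists2 z, K_ m z & enorm (y - z) < e]) -> K y.
  move=> Sy yK; split=> // e e0; apply: filterS (yK e e0) => m [z].
  by rewrite KE => -[_ Cz] yz; exists z.
exists K => // e N e0.
have e2 : 0 < e / 2 by rewrite divr_gt0.
have G1 : G [set m | forall x, K_ m x -> exists2 y, K y & enorm (x - y) <= e].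
  have [//|Gc] := in_ultra_setVsetC
    [set m | forall x, K_ m x -> exists2 y, K y & enorm (x - y) <= e] UG.
  (* [x_ m] is a point of [K_ m] at distance more than e from [K] whenever there is one, and a
     filler otherwise. The limit along [G] lies in [K], so it contradicts remoteness for the indices
     in the complement. *)
  have /choice[x_ x_P] : forall m, exists x, K_ m x /\
      ((exists2 x, K_ m x & forall y, K y -> e < enorm (x - y)) ->
        forall y, K y -> e < enorm (x - y)).
    move=> m; have [[x Kx h]|h] := pselect (exists2 x, K_ m x & forall y, K y -> e < enorm (x - y)).
      by exists x.
    by exists (w_ m); split=> //; exact: (w_P m).1.
  have [x Sx xlim] := limS x_ (fun m => spherical_body_sub (bK m) (x_P m).1).
  have Kx : K x.
    apply: Klim => // r r0; apply: filterS (xlim r r0) => m xm.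
    by exists (x_ m) => //; exact: (x_P m).1.
  have [m [mc xm]] := filter_ex (filterI Gc (xlim e e0)); exfalso.
  apply: mc => z Kz; apply: contrapT => h.
  have := (x_P m).2 _ x Kx; rewrite enormB => /(_ _)/lt_trans-/(_ _ _ xm).
  rewrite ltxx => F; apply/notF/F; exists z => // y Ky; rewrite ltNge; apply/negP => zy.
  by apply: h; exists y.
have G2 : G [set m | forall y, K y -> exists2 x, K_ m x & enorm (y - x) <= e].
  have [//|Gc] := in_ultra_setVsetC
    [set m | forall y, K y -> exists2 x, K_ m x & enorm (y - x) <= e] UG.
  have /choice[y_ y_P] : forall m, exists y, K y /\
      ((exists2 y, K y & forall x, K_ m x -> e < enorm (y - x)) ->
        forall x, K_ m x -> e < enorm (y - x)).
    move=> m; have [[y Ky h]|h] := pselect (exists2 y, K y & forall x, K_ m x -> e < enorm (y - x)).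
      by exists y.
    by exists w.
  have [y Sy ylim] := limS y_ (fun m => (y_P m).1.1).
  have Ky : K y.
    apply: Klim => // r r0; have r2 : 0 < r / 2 by rewrite divr_gt0.
    have [k yk] := filter_ex (ylim _ r2).
    apply: filterS (limK _ _ (y_P k).1 r2) => m [z Kz yz]; exists z => //.
    by have := enorm_sub_le y (y_ k) z; move: yk => /= yk; lra.
  (* Here the far points [y_ m] lie in [K]; half of e brings [y_ m] to its limit y, the other half
     brings y to a point of [K_ m]. *)
  have [m [[mc ym] [z Kz yz]]] := filter_ex (filterI (filterI Gc (ylim _ e2)) (limK _ _ Ky e2)).
  exfalso; apply: mc => y' Ky'; apply: contrapT => h.
  have : e < enorm (y_ m - z).
    apply: (y_P m).2 => //; exists y' => // x Kx; rewrite ltNge; apply/negP => xy.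
    by apply: h; exists x.
  by have := enorm_sub_le (y_ m) y z; rewrite (enormB _ y); move: ym => /= ym; lra.
(* As [G] refines [\oo], the good indices are unbounded. *)
have GN : G [set m | (N <= m)%N] by apply: ooG; exact: nbhs_infty_ge.
have [m [[m1 m2] mN]] := filter_ex (filterI (filterI G1 G2) GN).
by exists m.
Qed.

End Hausdorff.

(** * The Crofton cell *)

Section Cells.
Variables (R : realType) (n : nat).
Local Notation V := 'rV[R]_n.
Local Notation S := (sphere R n).
Implicit Types (Y Z A : set V) (p x y z u v w : V) (t e : R).

Lemma nbhs_enorm p A : nbhs p A -> exists2 r, 0 < r & forall y, enorm (p - y) < r -> A y.
Proof.
move=> /nbhs_ballP[r /= r0 rA]; exists r => // y py; apply: rA; split=> // i j.
rewrite ord1 /ball/=; apply: le_lt_trans py.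
by have := coord_le_enorm (p - y) j; rewrite !mxE.
Qed.

(** A nonnegative product means that z is on the same closed side of x^perp as p, whichever side
    this is. *)
Definition cell p Y : set V :=
  [set z | S z /\ forall x, Y x -> 0 <= dot z x * dot p x].

Definition open_cell p Y : set V :=
  [set z | S z /\ forall x, Y x -> 0 < dot z x * dot p x].

Lemma open_cell_complement p Y : open_cell p Y `<=` hypersphere_complement Y.
Proof.
move=> z [Sz zY]; split=> // -[x Yx]; rewrite /hyperplane/= dotC => zx.
by have := zY x Yx; rewrite zx mul0r ltxx.
Qed.

Lemma segment_component A u v : (forall t, 0 <= t <= 1 -> (1 - t) *: u + t *: v != 0) ->
  (forall t, 0 <= t <= 1 -> A (normalize ((1 - t) *: u + t *: v))) -> S u -> S v ->
  connected_component A u v.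
Proof.
move=> uv0 uvA Su Sv.
pose g t : V := (1 - t) *: u + t *: v; pose f t := normalize (g t).
have normS x : S x -> normalize x = x by rewrite /normalize => ->; rewrite invr1 scale1r.
have f0 : f 0 = u by rewrite /f /g subr0 scale1r scale0r addr0 normS.
have f1 : f 1 = v by rewrite /f /g subrr scale1r scale0r add0r normS.
exists (f @` `[0, 1]%classic).
  split; first by exists 0; rewrite //= in_itv/= lexx ler01.
    by move=> _ [t t01 <-]; apply: uvA; move: t01; rewrite /= in_itv.
  apply: connected_continuous_connected; first exact: segment_connected.
  apply: continuous_in_subspaceT => t; rewrite inE/= in_itv/= => t01.
  have cg : continuous g.
    move=> s; apply: (@continuousD R V R (fun t => (1 - t) *: u) (fun t => t *: v)).
      apply: (@continuousZ R V R (fun t => 1 - t) (fun=> u)); last exact: cst_continuous.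
      by apply: (@continuousB R R R (fun=> 1) id); [exact: cst_continuous | exact: cvg_id].
    by apply: (@continuousZ R V R id (fun=> v)); [exact: cvg_id | exact: cst_continuous].
  apply: (@continuousZ R V R (fun t => (enorm (g t))^-1) g); last exact: cg.
  apply: (@continuousV R R (fun t => enorm (g t))); first by rewrite enorm_eq0 uv0.
  by apply: (@continuous_comp R V R g (@enorm R n)); [exact: cg | exact: continuous_enorm].
by exists 1; rewrite //= in_itv/= lexx ler01.
Qed.

(** On a connected part of the complement <., x> takes an interval of values that avoids 0. *)
Lemma component_sign Y y z x : connected_component (hypersphere_complement Y) y z ->
  Y x -> 0 < dot z x * dot y x.
Proof.
move=> [D [Dy DY cD] Dz] Yx.
have nz w : D w -> dot w x != 0.
  move=> Dw; have [_ h] := DY w Dw; apply/eqP => wx; apply: h; exists x => //.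
  by rewrite /hyperplane/= dotC.
have /connected_intervalP itv : connected ((fun w => dot w x) @` D).
  apply: connected_continuous_connected => //.
  by apply: continuous_subspaceT; exact: continuous_dotl.
have no0 : ~ ((fun w => dot w x) @` D) 0.
  by move=> [w Dw wx]; have := nz w Dw; rewrite wx eqxx.
have := nz y Dy; have := nz z Dz; rewrite !neq_lt => /orP[z0|z0] /orP[y0|y0].
- by rewrite nmulr_rgt0.
- case: no0; apply: (itv (dot z x) (dot y x)); [by exists z | by exists y |].
  by rewrite !ltW.
- case: no0; apply: (itv (dot y x) (dot z x)); [by exists y | by exists z |].
  by rewrite !ltW.
- exact: mulr_gt0.
Qed.

Lemma open_cell_perturb p Y z t : S p -> (forall x, Y x -> dot p x != 0) ->
  cell p Y z -> 0 < t -> z + t *: p != 0 -> open_cell p Y (normalize (z + t *: p)).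
Proof.
move=> Sp pY [Sz zY] t0 zp0; split; first exact: normalize_sphere.
move=> x Yx; rewrite dotZl dotDl dotZl -mulrA pmulr_rgt0 ?invr_gt0 ?enorm_gt0//.
rewrite mulrDl ltr_wpDl ?zY// -mulrA mulr_gt0// lt_def -expr2 sqr_ge0 andbT.
by rewrite sqrf_eq0 pY.
Qed.

(** The chord from z to p satisfies all the strict inequalities; as [Y] is nonempty it therefore
    misses the origin and projects to an arc in the complement. *)
Lemma open_cell_component p Y : S p -> Y !=set0 -> (forall x, Y x -> dot p x != 0) ->
  open_cell p Y `<=` connected_component (hypersphere_complement Y) p.
Proof.
move=> Sp [x0 Yx0] pY z [Sz zY]; apply: connected_component_sym.
have pp x : Y x -> 0 < dot p x * dot p x.
  by move=> Yx; rewrite lt_def -expr2 sqr_ge0 sqrf_eq0 pY.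
have pos t x : Y x -> 0 <= t <= 1 -> 0 < dot ((1 - t) *: z + t *: p) x * dot p x.
  move=> Yx /andP[t0 t1]; rewrite dotDl !dotZl mulrDl -!mulrA.
  have z0 := zY x Yx; have p0 := pp x Yx.
  have [t1'|t1'] := ltP t 1.
    by apply: ltr_pwDl; [rewrite mulr_gt0// subr_gt0 | rewrite mulr_ge0// ltW].
  apply: ltr_wpDl; first by rewrite mulr_ge0 ?subr_ge0// ltW.
  by rewrite mulr_gt0// (lt_le_trans ltr01).
have nz t : 0 <= t <= 1 -> (1 - t) *: z + t *: p != 0.
  move=> /(pos t x0 Yx0); apply: contraTneq => ->.
  by rewrite dot0l mul0r ltxx.
apply: segment_component => // t t01; apply: (@open_cell_complement p).
split; first exact/normalize_sphere/nz.
move=> x Yx; rewrite dotZl -mulrA pmulr_rgt0 ?pos// invr_gt0 enorm_gt0.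
exact: nz.
Qed.

Lemma connected_sphere : (2 <= n)%N -> forall u v, S u -> S v -> connected_component S u v.
Proof.
move=> n2.
have H u v : S u -> S v -> v != - u -> connected_component S u v.
  move=> Su Sv vu.
  have nz t : 0 <= t <= 1 -> (1 - t) *: u + t *: v != 0.
    move=> /andP[t0 t1]; apply/eqP => h.
    have /(congr1 (@enorm R n)) : (1 - t) *: u = - (t *: v).
      by apply/eqP; rewrite -subr_eq0 opprK h.
    rewrite enormN !enormZ Su Sv !mulr1 !ger0_norm ?subr_ge0// => t2.
    have t12 : t = 2^-1 by lra.
    move: h; rewrite t2 t12 -scalerDr => /eqP; rewrite scaler_eq0 invr_eq0 pnatr_eq0/=.
    by rewrite addrC addr_eq0 (negPf vu).
  by apply: segment_component => // t t01; exact/normalize_sphere/nz.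
have basis := @sphere_delta_mx R n.
move=> u v Su Sv; have [vu|] := eqVneq v (- u); last exact: H.
pose i0 : 'I_n := Ordinal (ltnW n2); pose i1 : 'I_n := Ordinal n2.
(* Antipodal points are joined through a third point; one of the first two basis vectors differs
   from both u and - u. *)
have [q [Sq qu qv]] : exists q, [/\ S q, q != u & q != - u].
  pose e0 : V := delta_mx 0 i0; pose e1 : V := delta_mx 0 i1.
  have e00 : e0 0 i0 = 1 by rewrite mxE !eqxx.
  have e10 : e1 0 i0 = 0 by rewrite mxE.
  have e11 : e1 0 i1 = 1 by rewrite mxE !eqxx.
  have e01 : e0 0 i1 = 0 by rewrite mxE.
  have [E|E] := eqVneq e0 u.
    exists e1; split; first exact: basis.
      by apply/eqP => F; move: e10; rewrite F -E e00 => /eqP; rewrite oner_eq0.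
    by apply/eqP => F; move: e10; rewrite F -E mxE e00 => /eqP; rewrite oppr_eq0 oner_eq0.
  have [E'|E'] := eqVneq e0 (- u); last by exists e0; split=> //; exact: basis.
  exists e1; split; first exact: basis.
    have uE : u = - e0 by rewrite E' opprK.
    by apply/eqP => F; move: e10; rewrite F uE mxE e00 => /eqP; rewrite oppr_eq0 oner_eq0.
  by apply/eqP => F; move: e10; rewrite F -E' e00 => /eqP; rewrite oner_eq0.
apply: (@connected_component_trans _ _ q); first exact: H.
by apply: H => //; rewrite vu eqr_opp eq_sym.
Qed.

Lemma closed_cell p Y : closed (cell p Y).
Proof.
rewrite (_ : cell p Y = S `&` \bigcap_(x in Y) [set z : V | 0 <= dot z (dot p x *: x)]).
  by apply: closedI; [exact: closed_sphere | apply: closed_bigI => x _; exact: closed_dot_ge].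
by apply/seteqP; split=> z [Sz zY]; split=> // x Yx; have := zY x Yx; rewrite /= dotZr mulrC.
Qed.

Lemma near_normalize_perturb p z t : S p -> S z -> 0 < t < 1 ->
  z + t *: p != 0 /\ enorm (normalize (z + t *: p) - z) <= 2 * t.
Proof.
move=> Sp Sz /andP[t0 t1].
have tp : enorm (t *: p) = t by rewrite enormZ Sp mulr1 gtr0_norm.
have zp : z + t *: p != 0.
  apply/eqP => /eqP; rewrite addr_eq0 => /eqP zE; move: Sz; rewrite /sphere/= zE enormN tp.
  by move=> t1'; rewrite t1' ltxx in t1.
split=> //; apply: le_trans (normalize_near Sz zp) _.
by rewrite addrC addKr tp.
Qed.

Lemma closure_open_cell p Y : S p -> (forall x, Y x -> dot p x != 0) ->
  closure (open_cell p Y) = cell p Y.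
Proof.
move=> Sp pY; apply/seteqP; split.
  rewrite [X in _ `<=` X]((closure_id _).1 (@closed_cell p Y)).
  by apply: closureS => z [Sz zY]; split=> // x Yx; exact/ltW/zY.
move=> z zc A /nbhs_enorm[r r0 rA].
(* The push moves z by at most 2 t <= r / 2 < r, and t < 1 keeps z + t p away from 0. *)
pose t := Num.min (1 / 2) (r / 4).
have t0 : 0 < t by rewrite lt_min !divr_gt0.
have t1 : t < 1 by rewrite gt_min; apply/orP; left; lra.
have tr : t <= r / 4 by rewrite ge_min lexx orbT.
have [zp near] := near_normalize_perturb Sp zc.1 (introT andP (conj t0 t1)).
exists (normalize (z + t *: p)); split; first exact: open_cell_perturb.
by apply: rA; rewrite enormB; lra.
Qed.

Lemma cell_component p Y : (2 <= n)%N -> S p -> (forall x, Y x -> dot p x != 0) ->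
  closure (connected_component (hypersphere_complement Y) p) = cell p Y.
Proof.
move=> n2 Sp pY; have [->|/set0P Y0] := eqVneq Y set0.
  rewrite /hypersphere_complement bigcup_set0 setD0.
  rewrite (_ : connected_component S p = S); last first.
    apply/seteqP; split; first exact: connected_component_sub.
    by move=> z Sz; exact: connected_sphere.
  rewrite -((closure_id _).1 (@closed_sphere R n)).
  by apply/seteqP; split=> z; [move=> Sz; split | case].
rewrite -closure_open_cell//; congr closure; apply/seteqP; split; last exact: open_cell_component.
move=> z zp; split; last by move=> x Yx; exact: component_sign zp Yx.
by have := connected_component_sub zp; case.
Qed.

Lemma closure_component_sign Y y z x : Y x ->
  closure (connected_component (hypersphere_complement Y) y) z ->
  0 <= dot z x * dot y x.
Proof.
move=> Yx Zz; have cl := (closure_id _).1 (@closed_dot_ge R n 0 (dot y x *: x)).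
have : closure [set z : V | 0 <= dot z (dot y x *: x)] z.
  apply: closureS Zz => w wy; rewrite /= dotZr mulrC; apply: ltW.
  exact: component_sign wy Yx.
by rewrite -cl/= dotZr mulrC.
Qed.

Lemma interior_point_mem Z p : S p -> interior_point Z p -> Z p.
Proof. by move=> Sp iZ; exact: (nbhs_singleton iZ). Qed.

Lemma interior_point_cell p Y : S p -> finite_set Y -> (forall x, Y x -> dot p x != 0) ->
  interior_point (cell p Y) p.
Proof.
move=> Sp /finite_fsetP[F ->] pY.
have : nbhs p (\bigcap_(x in [set` F]) [set z : V | 0 < dot z (dot p x *: x)]).
  apply: filter_bigI => x Fx; apply: open_nbhs_nbhs; split; first exact: open_dot_gt.
  by rewrite /= dotZr lt_def -expr2 sqr_ge0 sqrf_eq0 pY.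
apply: filterS => z zF Sz; split=> // x Fx; apply: ltW.
by have := zF x Fx; rewrite /= dotZr mulrC.
Qed.

(** Uniqueness: if p lies in the closure of the component of y, then y is weakly, hence strictly, on
    the side of p for each x in [Y], so y is in the component of p. *)
Lemma crofton_cellE p Y : (2 <= n)%N -> S p -> finite_set Y ->
  (forall x, Y x -> dot p x != 0) -> crofton_cell p Y = cell p Y.
Proof.
move=> n2 Sp finY pY; apply: xget_unique.
  split; last exact: interior_point_cell.
  exists p; last exact: cell_component.
  by apply: (@open_cell_complement p); split=> // x Yx; rewrite lt_def -expr2 sqr_ge0 sqrf_eq0 pY.
move=> Z [[y Yy <-] /(interior_point_mem Sp) Zp].
rewrite -cell_component//; congr closure.
apply: same_connected_component; apply: connected_component_sym.
have [->|/set0P Y0] := eqVneq Y set0.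
  rewrite /hypersphere_complement bigcup_set0 setD0; apply: connected_sphere => //.
  by case: Yy.
apply: open_cell_component => //; split; first by case: Yy.
move=> x Yx; rewrite mulrC lt_def (closure_component_sign Yx Zp) andbT.
rewrite mulf_neq0 ?pY//; case: Yy => _ h; apply/eqP => yx; apply: h.
by exists x => //; rewrite /hyperplane/= dotC.
Qed.

(** From p on x^perp, small steps along x or - x reach the side opposite to any given component.
    Hence p is interior to no cell, and [crofton_cell] takes its default value. *)
Lemma crofton_cell_degenerate p Y x : S p -> Y `<=` S -> Y x -> dot p x = 0 ->
  crofton_cell p Y = S.
Proof.
move=> Sp YS Yx px; apply: xgetPN => _ [[y Yy <-] /nbhs_enorm[r r0 rZ]].
have Sx := YS x Yx.
have yx : dot y x != 0.
  case: Yy => _ h; apply/eqP => yx; apply: h.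
  by exists x => //; rewrite /hyperplane/= dotC.
pose v := if 0 < dot y x then - x else x.
have Sv : S v by rewrite /v; case: ifP => // _; exact: sphereN.
have vx : dot v x * dot y x < 0.
  rewrite /v; case: (ltP 0 (dot y x)) => h; first by rewrite dotNl sphere_dot// mulN1r oppr_lt0.
  by rewrite sphere_dot// mul1r lt_neqAle yx.
pose t := Num.min (1 / 2) (r / 4).
have t0 : 0 < t by rewrite lt_min !divr_gt0.
have t1 : t < 1 by rewrite gt_min; apply/orP; left; lra.
have tr : t <= r / 4 by rewrite ge_min lexx orbT.
have [pv near] := near_normalize_perturb Sv Sp (introT andP (conj t0 t1)).
have near' : enorm (p - normalize (p + t *: v)) < r by rewrite enormB; lra.
have := closure_component_sign Yx (rZ _ near' (normalize_sphere pv)).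
rewrite dotZl dotDl px add0r dotZl -!mulrA pmulr_rge0 ?invr_gt0 ?enorm_gt0//.
by rewrite pmulr_rge0// leNgt vx.
Qed.

Lemma spherical_body_cell p Y : S p -> Y !=set0 -> (forall x, Y x -> dot p x != 0) ->
  spherical_body (cell p Y).
Proof.
move=> Sp [x0 Yx0] pY.
exists (\bigcap_(x in Y) [set z : V | 0 <= dot z (dot p x *: x)]); split.
- apply: closed_convex_coneP.
  + by apply: closed_bigI => x _; exact: closed_dot_ge.
  + by move=> x _; rewrite /= dot0l.
  + by move=> u v Cu Cv x Yx; rewrite /= dotDl addr_ge0// ?Cu ?Cv.
  + by move=> t u t0 Cu x Yx; rewrite /= dotZl mulr_ge0// Cu.
- move=> [U UE].
  have Up : [set` U] p by rewrite -UE => x Yx; rewrite /= dotZr -expr2 sqr_ge0.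
  have : [set` U] (- p) by rewrite /= memvN.
  rewrite -UE => /(_ x0 Yx0); rewrite /= dotNl dotZr leNgt oppr_lt0 => /negP; apply.
  by rewrite lt_def -expr2 sqr_ge0 sqrf_eq0 pY.
- by apply/seteqP; split=> z [Sz zY]; split=> // x Yx; have := zY x Yx; rewrite /= dotZr mulrC.
Qed.

Lemma cell_set0 p : cell p set0 = S.
Proof. by apply/seteqP; split=> z; [case | move=> Sz; split]. Qed.

(** A point of [K] strictly separated from p by x^perp would make x cross [K], hence hit it. *)
Lemma sub_cell p Y K : spherical_body K -> K p -> (forall x, Y x -> ~ hitting K x) ->
  K `<=` cell p Y.
Proof.
move=> bK Kp YK z Kz; split; first exact: spherical_body_sub Kz.
move=> x Yx; rewrite leNgt; apply/negP => zp; apply: (YK x Yx).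
apply: (crossing_hitting bK (lexx 0)); rewrite (dotC z) (dotC p) in zp.
have [h|h|h] := ltgtP (dot x z) 0; last by rewrite h mul0r ltxx in zp.
  by split; [exists p => //; nra | exists z; rewrite ?oppr0].
by split; [exists z | exists p => //; rewrite oppr0; nra].
Qed.

Lemma cell_not_crossing p Y x : Y x -> dot p x != 0 -> ~ crossing (cell p Y) 0 x.
Proof.
move=> Yx px [[u [_ uY] xu] [v [_ vY] xv]]; rewrite oppr0 in xv.
have := uY x Yx; have := vY x Yx; rewrite !(dotC _ x).
rewrite (nmulr_rge0 _ xv) (pmulr_rge0 _ xu) => h h'.
by move: px; rewrite dotC eq_le h h'.
Qed.

End Cells.

(** * Perturbation of cells *)

Lemma seq_pos_lower_bound (R : realType) (T : eqType) (s : seq T) (f : T -> R) :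
  (forall x, x \in s -> 0 < f x) ->
  exists2 c, 0 < c & forall x, x \in s -> c <= f x.
Proof.
elim: s => [|y s IH] f0; first by exists 1.
have [|c c0 cf] := IH; first by move=> x xs; apply: f0; rewrite inE xs orbT.
exists (Num.min c (f y)); first by rewrite lt_min c0 f0// inE eqxx.
move=> x; rewrite inE => /predU1P[->|xs]; first by rewrite ge_min lexx orbT.
by rewrite ge_min cf.
Qed.

Lemma finite_set_pos_lower_bound (R : realType) (T : choiceType) (Y : set T) (f : T -> R) :
  finite_set Y -> (forall x, Y x -> 0 < f x) ->
  exists2 c, 0 < c & forall x, Y x -> c <= f x.
Proof. by move=> /finite_fsetP[F ->] f0; apply: (seq_pos_lower_bound (s := F)). Qed.

Section Grid.
Variables (R : realType) (n : nat).
Local Notation V := 'rV[R]_n.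
Local Notation S := (sphere R n).
Implicit Types (Y K : set V) (p x y z : V) (t e : R).

(** One map serves both inclusions: pushing z by t p towards p adds t <p, x>^2 to each defining
    product, which outweighs the error made by replacing x with phi x. *)
Lemma cell_close p Y e : S p -> finite_set Y -> Y `<=` S ->
  (forall x, Y x -> dot p x != 0) -> 0 < e ->
  exists2 rho, 0 < rho & forall phi : V -> V,
    (forall x, Y x -> enorm (x - phi x) <= rho) ->
    (forall x', (phi @` Y) x' -> dot p x' != 0) /\
    euclid_close e (cell p Y) (cell p (phi @` Y)).
Proof.
move=> Sp finY YS pY e0.
have [x Yx|c c0 cY] := @finite_set_pos_lower_bound R V Y (fun x => dot p x * dot p x) finY.
  by rewrite lt_def -expr2 sqr_ge0 sqrf_eq0 pY.
pose t := Num.min (1 / 2) (e / 2).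
have t0 : 0 < t by rewrite lt_min !divr_gt0.
have t1 : t < 1 by rewrite gt_min; apply/orP; left; lra.
have te : t <= e / 2 by rewrite ge_min lexx orbT.
(* For rho <= 1 each product changes by at most 3 rho. The push gains at least t (c - 3 rho) with t
   <= 1, so 6 rho <= t c suffices. *)
pose rho := Num.min 1 (t * c / 6).
have rho0 : 0 < rho by rewrite lt_min ltr01 divr_gt0// mulr_gt0.
have rho1 : rho <= 1 by rewrite ge_min lexx.
have rhoc : 6 * rho <= t * c.
  have : rho <= t * c / 6 by rewrite ge_min lexx orbT.
  by rewrite ler_pdivlMr// mulrC.
exists rho => // phi phiY.
have est x u : Y x -> S u ->
    `|dot u (phi x) * dot p (phi x) - dot u x * dot p x| <= 3 * rho.
  move=> Yx Su; have d := phiY x Yx.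
  have h v : S v -> `|dot v (phi x) - dot v x| <= rho.
    move=> Sv; rewrite -dotBr; apply: le_trans (dot_le_enorm _ _) _.
    by rewrite Sv mul1r enormB.
  have h1 v : S v -> `|dot v x| <= 1.
    by move=> Sv; apply: le_trans (dot_le_enorm _ _) _; rewrite Sv (YS x Yx) mulr1.
  have hu := h u Su; have hp := h p Sp; have h1u := h1 u Su; have h1p := h1 p Sp.
  have -> : dot u (phi x) * dot p (phi x) - dot u x * dot p x =
    (dot u (phi x) - dot u x) * (dot p (phi x) - dot p x) +
    (dot u (phi x) - dot u x) * dot p x + dot u x * (dot p (phi x) - dot p x) by ring.
  apply: le_trans (ler_normD _ _) _; apply: le_trans (lerD (ler_normD _ _) (lexx _)) _.
  rewrite !normrM.
  have a1 : `|dot u (phi x) - dot u x| * `|dot p (phi x) - dot p x| <= rho * 1.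
    by apply: ler_pM => //; exact: le_trans rho1.
  have a2 : `|dot u (phi x) - dot u x| * `|dot p x| <= rho * 1 by exact: ler_pM.
  have a3 : `|dot u x| * `|dot p (phi x) - dot p x| <= 1 * rho by exact: ler_pM.
  by lra.
have tc : t * c < c by rewrite gtr_pMl.
have pphi x : Y x -> c - 3 * rho <= dot p (phi x) * dot p (phi x).
  move=> Yx; have := est x p Yx Sp; rewrite ler_norml => /andP[h _].
  by have := cY x Yx; lra.
split=> [_ [x Yx <-]|].
  apply/eqP => px; have := pphi x Yx; rewrite px mul0r; lra.
have close z : S z -> enorm (z - normalize (z + t *: p)) <= e /\ z + t *: p != 0.
  move=> Sz; have [zp near] := near_normalize_perturb Sp Sz (introT andP (conj t0 t1)).
  by split=> //; rewrite enormB; lra.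
have mem z x : S z -> 0 <= dot z x * dot p x + t * (dot p x * dot p x) ->
    0 <= dot (normalize (z + t *: p)) x * dot p x.
  move=> Sz h; have [_ zp] := close z Sz.
  by rewrite dotZl dotDl dotZl -mulrA pmulr_rge0 ?invr_gt0 ?enorm_gt0// mulrDl -mulrA.
split=> z [Sz zY]; have [zc zp] := close z Sz;
  exists (normalize (z + t *: p)) => //; (split; first exact: normalize_sphere).
  move=> _ [x Yx <-]; apply: mem => //.
  have := est x z Yx Sz; rewrite ler_norml => /andP[h _].
  have := zY x Yx; have := pphi x Yx => h1 h2.
  have : t * (c - 3 * rho) <= t * (dot p (phi x) * dot p (phi x)) by rewrite ler_pM2l.
  have : t * rho <= rho by rewrite ger_pMl// ltW.
  by lra.
move=> x Yx; apply: mem => //.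
have := est x z Yx Sz; rewrite ler_norml => /andP[_ h].
have h2 : 0 <= dot z (phi x) * dot p (phi x) by apply: zY; exists x.
have : t * c <= t * (dot p x * dot p x) by rewrite ler_pM2l// cY.
by lra.
Qed.

(** Rounding down to mesh 1 / (k + 1), with integer codes so that finite configurations are
    countably many. The rounded points may leave the sphere, which [cell] and [cell_close] allow. *)
Definition grid_code (k : nat) (x : V) : 'rV[int]_n :=
  \row_i Num.floor (k.+1%:R * x 0 i).

Definition grid_point (k : nat) (q : 'rV[int]_n) : V :=
  \row_i ((q 0 i)%:~R / k.+1%:R).

Lemma enorm_le_coord (x : V) (c : R) : 0 <= c -> (forall i, `|x 0 i| <= c) ->
  enorm x <= n%:R * c.
Proof.
move=> c0 xc; rewrite -(@ler_sqr R) ?nnegrE ?enorm_ge0 ?mulr_ge0// sqr_enorm dotE.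
have : \sum_i x 0 i * x 0 i <= \sum_(i < n) c ^+ 2.
  apply: ler_sum => i _; rewrite -expr2 -real_normK ?num_real//.
  by rewrite ler_sqr ?nnegrE ?normr_ge0.
move/le_trans; apply; rewrite sumr_const card_ord exprMn -[leLHS]mulr_natl.
rewrite ler_wpM2r ?sqr_ge0// -natrX ler_nat.
by case: n => // m; rewrite -{1}(expn1 m.+1) leq_pexp2l.
Qed.

Lemma grid_near k x : enorm (x - grid_point k (grid_code k x)) <= n%:R / k.+1%:R.
Proof.
apply: enorm_le_coord; first by rewrite invr_ge0.
move=> i; rewrite !mxE; set y := k.+1%:R * x 0 i.
have k0 : 0 < k.+1%:R :> R by [].
have -> : x 0 i - (Num.floor y)%:~R / k.+1%:R = (y - (Num.floor y)%:~R) / k.+1%:R.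
  by rewrite mulrBl /y mulrAC divff ?mul1r// gt_eqF.
have /andP[h1 h2] := floor_itv y; rewrite intrD in h2.
rewrite normrM (gtr0_norm (_ : 0 < _^-1)) ?invr_gt0// ler_piMl ?invr_ge0//.
by rewrite ger0_norm ?subr_ge0//; lra.
Qed.

Lemma measurable_grid_code k q : measurable ([set x : V | grid_code k x = q] : set (borel_rV R n)).
Proof.
rewrite (_ : [set _ | _] = \bigcap_(i in [set: 'I_n])
    ((fun x : borel_rV R n => (x : V) 0 i) @^-1`
       `[(q 0 i)%:~R / k.+1%:R, (q 0 i + 1)%:~R / k.+1%:R[%classic)).
  apply: fin_bigcap_measurable => // i _.
  by rewrite -[X in measurable X]setTI; exact: measurable_coord.
have E (x : V) i : (Num.floor (k.+1%:R * x 0 i) == q 0 i) =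
    (x 0 i \in `[(q 0 i)%:~R / k.+1%:R, (q 0 i + 1)%:~R / k.+1%:R[).
  by rewrite floor_eq in_itv/= ler_pdivrMr// ltr_pdivlMr// mulrC.
apply/seteqP; split=> [x xq i _|x h].
  have : Num.floor (k.+1%:R * x 0 i) == q 0 i by rewrite -xq mxE.
  by rewrite E.
by apply/rowP => i; rewrite mxE; apply/eqP; rewrite E; exact: (h i I).
Qed.

End Grid.

(** * Measurability and avoidance probabilities *)

Section FiniteProcess.
Variables (R : realType) (n : nat) (dT : measure_display) (T : measurableType dT).
Local Notation V := 'rV[R]_n.
Local Notation B := (borel_rV R n).
Local Notation S := (sphere R n).
Variable X : T -> set V.
Hypothesis Xfin : forall w, finite_set (X w) /\ X w `<=` S.
Hypothesis Xmeas : forall A : set B, measurable A ->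
  measurable_fun setT (point_count X A).

Definition avoiding (A : set V) : set T := [set w | forall x, X w x -> ~ A x].

Lemma avoidingE (A : set V) : avoiding A = [set w | point_count X A w = 0%N].
Proof.
apply/seteqP; split=> w; rewrite /point_count/=.
  move=> h; rewrite (_ : X w `&` A = set0) ?fset_set0//.
  by rewrite -subset0 => x [Xx Ax]; exact: (h x).
move=> /eqP; rewrite cardfs_eq0 => /eqP /fset_set_set0 h x Xx Ax.
(* [fset_set] is empty on infinite sets too, so a zero count says something only through finiteness
   of [X w]. *)
have /h E : finite_set (X w `&` A) by apply: finite_setIl; case: (Xfin w).
suff : set0 x by [].
by rewrite -E.
Qed.

Lemma measurable_avoiding (A : set B) : measurable A -> measurable (avoiding A).
Proof.
move=> mA; rewrite avoidingE -[X in measurable X]setTI.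
exact: (Xmeas mA measurableT (_ : measurable [set 0%N])).
Qed.

(** [G] is arbitrary: the set of codes takes countably many values, and each value is described by
    countably many conditions that a grid box is hit or avoided. *)
Lemma measurable_grid_fun k (G : set 'rV[int]_n -> R) :
  measurable_fun setT (fun w => G (grid_code k @` X w)).
Proof.
move=> _ C _; rewrite setTI.
pose E (s : seq 'rV[int]_n) : set T := [set w | grid_code k @` X w = [set` s]].
have mE s : measurable (E s).
  pose F (q : 'rV[int]_n) : set T :=
    if q \in s then ~` avoiding [set x | grid_code k x = q]
    else avoiding [set x | grid_code k x = q].
  have mF q : measurable (F q).
    have mv := measurable_avoiding (measurable_grid_code k q).
    by rewrite /F; case: ifP => // _; exact: measurableC.
  rewrite (_ : E s = ~` \bigcup_q ~` F q).
    apply: measurableC; apply: countable_bigcupT_measurable => // q.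
    exact: measurableC.
  rewrite setC_bigcup; apply/seteqP; split=> [w Ew q _|w Fw].
    rewrite setCK /F; case: ifPn => qs.
      have : [set` s] q by [].
      by rewrite -Ew => -[x Xx xq] h; exact: (h x).
    move=> x Xx xq; move/negP: qs; apply.
    by have : [set` s] q by rewrite -Ew; exists x.
  apply/seteqP; split=> [_ [x Xx <-]|q /= qs].
    have := Fw (grid_code k x) I; rewrite setCK /F/=; case: ifPn => // _ /(_ x Xx).
    by case.
  have := Fw q I; rewrite setCK /F qs => h; apply: contrapT => h'; apply: h => x Xx xq.
  by apply: h'; exists x.
rewrite (_ : _ @^-1` C =
    \bigcup_(s in [set: seq 'rV[int]_n]) (if `[< C (G [set` s]) >] then E s else set0)).
  by apply: countable_bigcupT_measurable => // s; case: ifP.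
apply/seteqP; split=> [w Cw|w [s _]].
  have /finite_seqP[s sE] : finite_set (grid_code k @` X w).
    by apply: finite_image; case: (Xfin w).
  exists s => //; rewrite asboolT; first exact: sE.
  by rewrite -sE.
by case: asboolP => // Cs Ew; rewrite /preimage/= Ew.
Qed.

Lemma measurable_crofton_event p (Sigma : set V -> R) (a : R) : (2 <= n)%N -> S p ->
  body_continuous Sigma -> a <= Sigma S ->
  measurable [set w | a <= Sigma (crofton_cell p (X w))].
Proof.
move=> n2 Sp cSigma aS.
pose H : set B := [set x | dot x p = 0].
have mH : measurable H by exact: measurable_orthogonal.
pose D := avoiding H; have mD : measurable D by exact: measurable_avoiding.
have DpY w : D w -> forall x, X w x -> dot p x != 0.
  by move=> Dw x Xx; apply/eqP => px; apply: (Dw x Xx); rewrite /H/= dotC.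
pose h (k : nat) (w : T) : R := Sigma (cell p ((@grid_point R n k) @` (grid_code k @` X w))).
have mf : measurable_fun D (fun w => Sigma (cell p (X w))).
  apply: (@measurable_fun_cvg _ _ _ D h) => [k|w Dw].
    apply: measurable_funTS.
    exact: (measurable_grid_fun k (fun Q => Sigma (cell p ((@grid_point R n k) @` Q)))).
  (* Without points the cell is the whole sphere, about which [body_continuous] says nothing; but
     the approximations are then constant. *)
  have [E|/set0P Y0] := eqVneq (X w) set0.
    rewrite (_ : h ^~ w = cst (Sigma (cell p (X w)))); first exact: cvg_cst.
    by apply/funext => k; rewrite /h E !image_set0.
  have [finY YS] := Xfin w; have pY := DpY w Dw.
  apply/cvgrPdist_lt => eps eps0.
  have bodyC := spherical_body_cell Sp Y0 pY.
  have [e e0 He] := body_continuous_close cSigma bodyC eps0.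
  have [rho rho0 Hrho] := cell_close Sp finY YS pY e0.
  have : \forall k \near \oo, n%:R / k.+1%:R <= rho.
    near=> k; rewrite ler_pdivrMr// -ler_pdivrMl// mulrC.
    apply: (@le_trans _ _ k%:R); last by rewrite ler_nat.
    by near: k; exact: nbhs_infty_ger.
  apply: filterS => k kr; rewrite /h image_comp.
  have [pY' close] := Hrho (@grid_point R n k \o grid_code k)
    (fun x _ => le_trans (grid_near k x) kr).
  rewrite distrC; apply: He => //; apply: spherical_body_cell => //.
  by move: Y0 => [y Yy]; exists ((@grid_point R n k \o grid_code k) y), y.
rewrite (_ : [set w | _] =
    ~` D `|` (D `&` (fun w => Sigma (cell p (X w))) @^-1` `[a, +oo[%classic)).
  by apply: measurableU; [exact: measurableC | exact: mf].
apply/seteqP; split=> [w aw|w [nD|[Dw]]].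
- have [Dw|nD] := pselect (D w); [right | by left]; split=> //.
  rewrite /= in_itv/= andbT -(crofton_cellE n2 Sp (Xfin w).1)//.
  exact: DpY.
- have [x Xx Hx] : exists2 x, X w x & H x.
    apply: contrapT => nx; apply: nD => x Xx Hx; apply: nx; by exists x.
  by rewrite /= (crofton_cell_degenerate Sp (Xfin w).2 Xx)// dotC.
- rewrite /= in_itv/= andbT -(crofton_cellE n2 Sp (Xfin w).1)//.
  exact: DpY.
Unshelve. all: by end_near. Qed.

End FiniteProcess.

Lemma isotropic_poisson_avoiding (R : realType) (n : nat) (dT : measure_display)
    (T : measurableType dT) (P : probability T R) (X : T -> set 'rV[R]_n) (g : R)
    (A : set (borel_rV R n)) : 0 < g -> isotropic_poisson P X g -> measurable A ->
  P (avoiding X A) = (expR (- (g * fine (sigma_sphere A))))%:E.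
Proof.
move=> g0 [Xfin _ Xpoisson _] mA; rewrite (avoidingE Xfin) Xpoisson// /poisson_prob.
case: ifPn => [r0|].
  rewrite esum_set1; last by rewrite lee_fin poisson_pmf_ge0.
  by rewrite /poisson_pmf r0 expr0 fact0 divr1 mul1r.
(* At rate 0 [poisson_prob] falls back to a Dirac mass, which gives 1 = exp 0 as desired. *)
rewrite -leNgt => r0.
have -> : g * fine (sigma_sphere A) = 0.
  apply/eqP; rewrite eq_le r0/= mulr_ge0//; first exact: ltW.
  by apply: fine_ge0; exact: sigma_sphere_ge0.
by rewrite oppr0 expR0 diracE mem_set.
Qed.

(** * Rotations *)

Section Rotations.
Variables (R : realType) (n : nat).
Local Notation V := 'rV[R]_n.
Local Notation S := (sphere R n).
Implicit Types (p u v w x y : V) (K : set V).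

(** The Householder reflection 1 - 2 w^T w / <w, w> along w = u - v; it sends u to v because |u| =
    |v| gives <w, w> = 2 <u, w>. *)
Lemma reflection_exists u v : S u -> S v ->
  exists2 M : 'M[R]_n, M *m M^T = 1%:M & u *m M = v.
Proof.
move=> Su Sv; have [->|uv] := eqVneq u v.
  by exists 1%:M; rewrite ?trmx1 ?mulmx1.
have [w wE] : exists w, w = u - v by exists (u - v).
have w0 : dot w w != 0 by rewrite dotxx_eq0 wE subr_eq0.
have rankone x y : x *m y^T = (dot x y)%:M by rewrite [LHS]mx11_scalar.
have [Q QE] : exists Q : 'M[R]_n, Q = w^T *m w by exists (w^T *m w).
have QT : Q^T = Q by rewrite QE trmx_mul trmxK.
have QQ : Q *m Q = dot w w *: Q.
  by rewrite QE -mulmxA (mulmxA w) rankone mul_scalar_mx scalemxAr.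
have [c cE] : exists c, c * dot w w = 2 by exists (2 / dot w w); rewrite divfK.
exists (1%:M - c *: Q).
  have -> : (1%:M - c *: Q)^T = 1%:M - c *: Q.
    by apply/matrixP => i j; rewrite -[in LHS]QT !mxE eq_sym.
  rewrite mulmxBl mul1mx mulmxBr mulmx1.
  rewrite -scalemxAl -scalemxAr QQ !scalerA -mulrA cE -addrA -opprD -scalerBl -scalerDl.
  by rewrite [X in X *: Q](_ : _ = 0) ?scale0r ?oppr0 ?addr0//; ring.
rewrite mulmxBr mulmx1 -scalemxAr QE mulmxA rankone mul_scalar_mx scalerA.
rewrite (_ : c * dot u w = 1); first by rewrite scale1r wE opprB addrC subrK.
have uw : dot w w = 2 * dot u w.
  by rewrite wE dotBl !dotBr (dotC v u) !sphere_dot//; ring.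
by rewrite uw in cE; lra.
Qed.

(** If the reflection [H] has determinant -1, it is followed by Q^T D Q, which fixes v and has
    determinant -1: [Q] sends the first basis vector to v, and [D] flips the second coordinate. *)
Lemma rotation_exists u v : (2 <= n)%N -> S u -> S v ->
  exists2 M : 'M[R]_n, special_orthogonal M & u *m M = v.
Proof.
move=> n2 Su Sv; have [H HH uH] := reflection_exists Su Sv.
have detH : \det H ^+ 2 = 1 by rewrite expr2 -{2}det_tr -det_mulmx HH det1.
have [dH|dH] := eqVneq (\det H) 1; first by exists H.
have {}dH : \det H = -1.
  by move/eqP: detH; rewrite sqrf_eq1 (negPf dH)/= => /eqP.
pose i0 : 'I_n := Ordinal (ltnW n2); pose i1 : 'I_n := Ordinal n2.
pose e : V := delta_mx 0 i0.
have Se : S e by exact: sphere_delta_mx.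
have [Q QQ eQ] := reflection_exists Se Sv.
pose D : 'M[R]_n := diag_mx (\row_j (if j == i1 then -1 else 1)).
have QTQ : Q^T *m Q = 1%:M by exact: mulmx1C.
have DT : D^T = D by rewrite tr_diag_mx.
have DD : D *m D = 1%:M.
  rewrite mulmx_diag; apply/matrixP => i j; rewrite !mxE.
  by case: ifP; rewrite ?mulrNN ?mul1r// mulr1.
have detD : \det D = -1.
  rewrite det_diag (bigD1 i1)//= mxE eqxx big1 ?mulr1// => j /negPf ji.
  by rewrite mxE ji.
have eD : e *m D = e.
  rewrite mul_mx_diag; apply/rowP => j; rewrite !mxE eqxx/=.
  have [->|_] := eqVneq j i0; first by rewrite mulr1.
  by rewrite mul0r.
have detQ : \det Q * \det Q = 1 by rewrite -{1}det_tr -det_mulmx QTQ det1.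
exists (H *m (Q^T *m D *m Q)); first split.
- rewrite !trmx_mul trmxK DT -!mulmxA (mulmxA Q) QQ mul1mx (mulmxA D) DD mul1mx.
  by rewrite (mulmxA Q^T) QTQ mul1mx HH.
- by rewrite !det_mulmx det_tr detD dH; rewrite mulrN1 (mulNr (\det Q)) detQ mulrNN mulr1.
- by rewrite mulmxA uH -eQ !mulmxA -(mulmxA e) QQ mulmx1 eD.
Qed.

(** The rotated cone is a preimage under M^T, and the rotated pole shows that it is not a
    subspace. *)
Lemma spherical_body_mulmx (M : 'M[R]_n) K : M *m M^T = 1%:M -> spherical_body K ->
  spherical_body [set x *m M | x in K].
Proof.
move=> MM bK; have [w Kw wK] := spherical_body_pole bK.
have MTM : M^T *m M = 1%:M by exact: mulmx1C.
have Sw := spherical_body_sub bK Kw.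
have [C [coneC _ KE]] := bK; have [clC _ C0 CZ] := coneC.
pose C' : set V := [set z | C (z *m M^T)].
have -> : [set x *m M | x in K] = S `&` C'.
  rewrite KE; apply/seteqP; split=> [_ [x [Sx Cx] <-]|z [Sz Cz]].
    by split; rewrite /sphere/C'/= ?enorm_mulmx// -mulmxA MM mulmx1.
  exists (z *m M^T); last by rewrite -mulmxA MTM mulmx1.
  by split=> //; rewrite /sphere/= enorm_mulmx ?trmxK.
apply: (@spherical_body_of_pole _ _ C' (w *m M)).
- apply: closed_convex_coneP.
  + move=> z clz; apply: clC => A /nbhs_enorm[r r0 rA].
    have [u [Cu zu]] := clz _ (enorm_ball z r0).
    exists (u *m M^T); split=> //; apply: rA.
    by rewrite -mulmxBl enorm_mulmx// trmxK.
  + by rewrite /C'/= mul0mx.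
  + by move=> x y Cx Cy; rewrite /C'/= mulmxDl; exact: convex_coneD.
  + by move=> t x t0 Cx; rewrite /C'/= -scalemxAl; exact: CZ.
- by rewrite /C'/= -mulmxA MM mulmx1; move: Kw; rewrite KE => -[].
- by rewrite -enorm_eq0 enorm_mulmx// enorm_eq0 sphere_neq0.
- move=> y Cy; rewrite dot_mulmx.
  have [y0|y0] := eqVneq (y *m M^T) 0; first by rewrite y0 dot0r.
  have Ky : K (normalize (y *m M^T)).
    rewrite KE; split; first exact: normalize_sphere.
    by apply: CZ => //; rewrite invr_ge0 enorm_ge0.
  have := wK _ Ky; rewrite dotZr pmulr_rge0// invr_gt0.
  by rewrite enorm_gt0.
Qed.

Lemma hitting_functional_mulmx (M : 'M[R]_n) K : M *m M^T = 1%:M -> spherical_body K ->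
  hitting_functional [set x *m M | x in K] = hitting_functional K.
Proof.
move=> MM bK; have bK' := spherical_body_mulmx MM bK.
rewrite !hitting_functionalE; [|exact: spherical_body_compact|exact: spherical_body_compact].
have MTM : M^T *m M^T^T = 1%:M by rewrite trmxK; exact: mulmx1C.
have mH := measurable_hitting (spherical_body_compact bK).
rewrite -(sigma_sphere_mulmx MTM mH); congr (fine (sigma_sphere _)).
apply/seteqP; split=> [x [z [xz [y Ky yz]]]|x [y [xy Ky]]].
  exists y; split=> //; move: xz; rewrite -yz /hyperplane/= => <-.
  by rewrite dot_mulmx trmxK.
exists (y *m M); split; last by exists y.
by move: xy; rewrite /hyperplane/= dot_mulmx trmxK.
Qed.

End Rotations.

(** * Minimizers and large deviation bounds *)

Section Minimizer.
Variables (R : realType) (n : nat).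
Local Notation V := 'rV[R]_n.
Local Notation B := (borel_rV R n).
Local Notation S := (sphere R n).
Local Notation sigma := (@sigma_sphere R n).
Local Notation Phi := (@hitting_functional R n).
Implicit Types (K L : set V) (Sigma : set V -> R).

Lemma fine_sigma_le (A C : set B) : measurable A -> measurable C -> S `&` A `<=` C ->
  fine (sigma A) <= fine (sigma C).
Proof.
move=> mA mC AC; apply: fine_le; [exact: sigma_sphere_fin_num | exact: sigma_sphere_fin_num |].
have mS : measurable (S : set B) by apply: closed_measurable_rV; exact: closed_sphere.
by rewrite -sigma_sphereI; apply: sigma_sphere_le => //; exact: measurableI.
Qed.

Lemma hitting_functional_ge0 K : compact K -> 0 <= Phi K.
Proof.
move=> cK; rewrite hitting_functionalE//; apply: fine_ge0.
by apply: sigma_sphere_ge0; exact: measurable_hitting.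
Qed.

Lemma crossing_le_hitting_functional K e : spherical_body K -> 0 <= e ->
  fine (sigma (crossing K e)) <= Phi K.
Proof.
move=> bK e0; have cK := spherical_body_compact bK; rewrite hitting_functionalE//.
apply: fine_sigma_le; [exact: measurable_crossing | exact: measurable_hitting |].
by move=> x [_ xK]; exact: crossing_hitting xK.
Qed.

(** Compactness and lower semicontinuity in one statement. The margin e depends on the limit [K] and
    c only and serves infinitely many m; half of the margin found at [K] pays for the distance from
    [K] to [K_ m]. *)
Lemma superlevel_cluster Sigma (a : R) (K_ : nat -> set V) : body_continuous Sigma ->
  (forall m, superlevel Sigma a (K_ m)) ->
  exists2 K, superlevel Sigma a K & forall c, c < Phi K ->
    exists2 e, 0 < e & forall N, exists2 m, (N <= m)%N &
      c < fine (sigma (crossing (K_ m) e)).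
Proof.
move=> cSigma aK; have [K bK clK] := spherical_body_cluster (fun m => (aK m).1).
exists K.
  split=> //; rewrite leNgt; apply/negP => Ka.
  have d0 : 0 < a - Sigma K by rewrite subr_gt0.
  have [e e0 He] := body_continuous_close cSigma bK d0.
  have [m _ /euclid_close_sym close] := clK e 0 e0.
  have [bKm aKm] := aK m; have := He _ bKm close.
  by rewrite ltr_norml => /andP[_ h]; lra.
move=> c /(sigma_crossing_cvg bK)[e e0 ce].
exists (e / 2) => [|N]; first by rewrite divr_gt0.
have e2 : 0 < e / 2 by rewrite divr_gt0.
have [m Nm [_ close]] := clK (e / 2) N e2.
exists m => //; apply: lt_le_trans ce _.
apply: fine_sigma_le; [exact: measurable_crossing | exact: measurable_crossing |].
by apply: crossing_near; rewrite (_ : e - e / 2 = e / 2)//; lra.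
Qed.

Lemma tau_lbound Sigma (a : R) K : superlevel Sigma a K -> tau Phi Sigma a <= Phi K.
Proof.
move=> aK; apply: ge_inf; last by exists K.
exists 0 => _ [L [bL _] <-]; apply: hitting_functional_ge0.
exact: spherical_body_compact.
Qed.

(** Direct method: if the cluster body of a minimizing sequence had Phi K > tau, infinitely many
    terms would exceed the midpoint c of tau and Phi K. *)
Lemma tau_attained Sigma (a : R) : body_continuous Sigma -> superlevel Sigma a !=set0 ->
  exists2 K, superlevel Sigma a K & Phi K = tau Phi Sigma a.
Proof.
move=> cSigma [K0 aK0].
have hinf : has_inf [set Phi K | K in superlevel Sigma a].
  split; first by exists (Phi K0), K0.
  exists 0 => _ [L [bL _] <-]; apply: hitting_functional_ge0.
  exact: spherical_body_compact.
have /choice[K_ K_P] : forall m : nat, exists K, superlevel Sigma a K /\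
    Phi K < tau Phi Sigma a + m.+1%:R^-1.
  move=> m; have m0 : 0 < m.+1%:R^-1 :> R by rewrite invr_gt0.
  by have [_ [K aK <-] h] := inf_adherent m0 hinf; exists K.
have [K aK clK] := superlevel_cluster cSigma (fun m => (K_P m).1).
exists K => //; apply/eqP; rewrite eq_le tau_lbound// andbT leNgt; apply/negP => tK.
pose c := (tau Phi Sigma a + Phi K) / 2.
have cK : c < Phi K by rewrite /c; lra.
have tc : 0 < c - tau Phi Sigma a by rewrite /c; lra.
have [e e0 He] := clK c cK.
have [m Nm] := He (Num.trunc (c - tau Phi Sigma a)^-1).
have := crossing_le_hitting_functional (K_P m).1.1 (ltW e0).
have := (K_P m).2.
have : m.+1%:R^-1 < c - tau Phi Sigma a.
  rewrite invf_plt ?posrE//; apply: lt_le_trans (truncnS_gt _) _.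
  by rewrite ler_nat ltnS.
by move: (m.+1%:R^-1) => r h1 h2 h3; lra.
Qed.

(** Otherwise some [K_ m] fails with margin 1 / (m + 1) for every m. Their cluster body has Phi K >=
    tau > c, so one margin e works for infinitely many m, against 1 / (m + 1) <= e for large m. *)
Lemma crossing_uniform Sigma (a c : R) : body_continuous Sigma ->
  c < tau Phi Sigma a -> exists2 e, 0 < e & forall K, superlevel Sigma a K ->
    c < fine (sigma (crossing K e)).
Proof.
move=> cSigma ct; apply: contrapT => h.
have /choice[K_ K_P] : forall m : nat, exists K, superlevel Sigma a K /\
    fine (sigma (crossing K m.+1%:R^-1)) <= c.
  move=> m; apply: contrapT => hK; apply: h; exists m.+1%:R^-1; first by rewrite invr_gt0.
  by move=> K aK; rewrite ltNge; apply/negP => Kc; apply: hK; exists K.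
have [K aK clK] := superlevel_cluster cSigma (fun m => (K_P m).1).
have [e e0 He] := clK c (lt_le_trans ct (tau_lbound aK)).
have [m Nm] := He (Num.trunc e^-1); apply/negP; rewrite -leNgt.
apply: le_trans (K_P m).2.
apply: fine_sigma_le; [exact: measurable_crossing | exact: measurable_crossing |].
move=> x [_]; apply: crossing_le.
rewrite invf_ple ?posrE//; apply: ltW; apply: lt_le_trans (truncnS_gt _) _.
by rewrite ler_nat ltnS.
Qed.

End Minimizer.

Section LargeDeviations.
Variables (R : realType) (n : nat) (p : 'rV[R]_n).
Local Notation V := 'rV[R]_n.
Local Notation B := (borel_rV R n).
Local Notation S := (sphere R n).
Local Notation sigma := (@sigma_sphere R n).
Local Notation Phi := (@hitting_functional R n).
Hypothesis n2 : (2 <= n)%N.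
Hypothesis Sp : S p.
Variables (Sigma : set V -> R) (a : R).
Hypothesis cSigma : body_continuous Sigma.
Hypothesis incSigma : increasing_functional Sigma.
Hypothesis extSigma : extended_to_sphere Sigma.
Hypothesis rotSigma : rotation_invariant Sigma.

Let event (T : Type) (X : T -> set V) : set T :=
  [set w | a <= Sigma (crofton_cell p (X w))].

Lemma superlevel_sphere K : superlevel Sigma a K -> a <= Sigma S.
Proof. by move=> [bK aK]; exact: le_trans aK (extSigma bK). Qed.

Lemma measurable_event (dT : measure_display) (T : measurableType dT)
    (P : probability T R) (X : T -> set V) (g : R) :
  superlevel Sigma a !=set0 -> isotropic_poisson P X g -> measurable (event X).
Proof.
move=> [K aK] [Xfin Xmeas _ _].
by apply: (measurable_crofton_event Xfin Xmeas n2 Sp cSigma); exact: superlevel_sphere aK.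
Qed.

Lemma event_lower (dT : measure_display) (T : measurableType dT)
    (P : probability T R) (X : T -> set V) (g : R) K : 0 < g ->
  isotropic_poisson P X g -> superlevel Sigma a K ->
  (((expR (- (g * Phi K)))%:E) <= P (event X))%E.
Proof.
move=> g0 HX [bK aK]; have [w Kw _] := spherical_body_pole bK.
have [M rotM wM] := rotation_exists n2 (spherical_body_sub bK Kw) Sp.
have MM := rotM.1; have bK' := spherical_body_mulmx MM bK.
have SigmaK' := rotSigma rotM bK; have PhiK' := hitting_functional_mulmx MM bK.
set K' := [set x *m M | x in K] in bK' SigmaK' PhiK'.
have K'p : K' p by exists w.
have [Xfin Xmeas _ _] := HX.
have cK' := spherical_body_compact bK'.
rewrite -PhiK' hitting_functionalE// -(isotropic_poisson_avoiding g0 HX (measurable_hitting cK')).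
apply: le_measure; rewrite ?inE.
- by apply: (measurable_avoiding Xfin Xmeas); exact: measurable_hitting.
- by apply: measurable_event HX; exists K.
move=> t Xt; rewrite /event/=.
have pX x : X t x -> dot p x != 0.
  move=> Xx; apply/eqP => px; apply: (Xt x Xx); exists p; split=> //.
  by rewrite /hyperplane/= dotC.
rewrite crofton_cellE//; last by case: (Xfin t).
(* Without points the cell is the sphere, and the extension of [Sigma] replaces monotonicity on
   bodies. *)
have [->|/set0P X0] := eqVneq (X t) set0.
  by rewrite cell_set0; apply: (@superlevel_sphere K).
apply: le_trans aK _; rewrite -SigmaK'; apply: incSigma => //.
  exact: spherical_body_cell.
exact: sub_cell.
Qed.

Lemma probability_bigcup_avoiding_le (dT : measure_display) (T : measurableType dT)
    (P : probability T R) (X : T -> set V) (g c : R) (I : Type) (s : seq I)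
    (A : I -> set B) : 0 < g -> isotropic_poisson P X g ->
  (forall i, measurable (A i)) -> (forall i, c <= fine (sigma (A i))) ->
  (P (\big[setU/set0]_(i <- s) avoiding X (A i)) <= ((size s)%:R * expR (- (g * c)))%:E)%E.
Proof.
move=> g0 HX mA cA; have [Xfin Xmeas _ _] := HX.
elim: s => [|i s IH]; first by rewrite big_nil measure0 mul0r.
have mv j : measurable (avoiding X (A j)) by exact: (measurable_avoiding Xfin Xmeas).
rewrite big_cons; apply: le_trans (measureU2 _ _ _) _ => //.
  exact: bigsetU_measurable.
rewrite /= -natr1 mulrDl mul1r addrC EFinD leeD//.
rewrite (isotropic_poisson_avoiding g0 HX (mA i)) lee_fin ler_expR lerN2.
by rewrite ler_pM2l.
Qed.

Lemma sphere_net e : 0 < e -> exists F : {fset V},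
  forall x, S x -> exists2 t, t \in F & enorm (t - x) < e.
Proof.
move=> e0; have := @compact_sphere R n; rewrite compact_cover => /(_ V S).
move=> /(_ (fun t => interior [set y | enorm (t - y) < e])) [].
- by move=> t _; exact: open_interior.
- by move=> x Sx; exists x => //; apply: enorm_ball.
- by move=> F _ SF; exists F => x /SF[t tF /interior_subset xt]; exists t.
Qed.

(** [N] is fixed before the probability space and g: it counts subsets of a net, a prefactor that
    disappears on the logarithmic scale. *)
Lemma event_upper (c : R) : superlevel Sigma a !=set0 -> c < tau Phi Sigma a ->
  exists N : nat, forall (dT : measure_display) (T : measurableType dT)
    (P : probability T R) (X : T -> set V) (g : R), 0 < g ->
  isotropic_poisson P X g ->
  (P (event X) <= (N%:R * expR (- (g * c)))%:E)%E.
Proof.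
move=> neS ct; have [delta d0 Hdelta] := crossing_uniform cSigma ct.
have d2 : 0 < delta / 2 by rewrite divr_gt0.
have [F FS] := sphere_net d2.
(* Every index must yield a set of measure at least c, so [setT] stands in for crossing sets that
   are too small. [None] encodes the event that [X] is empty. *)
pose A (U : option {fset V}) : set B :=
  if U is Some U then
    if c < fine (sigma (crossing [set` U] (delta / 2))) then crossing [set` U] (delta / 2)
    else setT
  else setT.
have mA U : measurable (A U).
  by case: U => [U|] //=; case: ifP => // _; exact: measurable_crossing.
have cT : c < fine (sigma setT).
  have [K aK] := neS; apply: lt_le_trans (Hdelta K aK) _.
  by apply: fine_sigma_le => //; exact: measurable_crossing.
have cA U : c <= fine (sigma (A U)).
  by case: U => [U|] /=; [case: ifP => [/ltW//|_]|]; exact: ltW.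
pose s : seq (option {fset V}) := None :: [seq Some U | U <- enum_fset (fpowerset F)].
exists (size s) => dT T P X g g0 HX; have [Xfin Xmeas _ _] := HX.
pose H : set B := [set x | dot x p = 0].
have mH : measurable H by exact: measurable_orthogonal.
have mvH : measurable (avoiding X H) by exact: (measurable_avoiding Xfin Xmeas).
have PH : P (~` avoiding X H) = 0%E.
  rewrite probability_setC// (isotropic_poisson_avoiding g0 HX mH).
  by rewrite (sigma_hyperplane (sphere_neq0 Sp)) /= mulr0 oppr0 expR0 subee.
have mbig : measurable (\big[setU/set0]_(U <- s) avoiding X (A U)).
  by apply: bigsetU_measurable => U _; exact: (measurable_avoiding Xfin Xmeas).
have sub : event X `<=` ~` avoiding X H `|` \big[setU/set0]_(U <- s) avoiding X (A U).
  move=> w aw; have [nH|] := pselect (avoiding X H w); [right | by left].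
  have pX x : X w x -> dot p x != 0.
    by move=> Xx; apply/eqP => px; apply: (nH x Xx); rewrite /H/= dotC.
  have [X0|/set0P X0] := eqVneq (X w) set0.
    by rewrite /s big_cons; left; rewrite /avoiding/= X0 => x.
  have bZ := spherical_body_cell Sp X0 pX.
  have aZ : superlevel Sigma a (cell p (X w)).
    by split=> //; rewrite -(crofton_cellE n2 Sp (Xfin w).1 pX).
  pose U := [fset t in F | `[< exists2 y, cell p (X w) y & enorm (t - y) <= delta / 2 >]]%fset.
  have UP t : t \in U -> exists2 y, cell p (X w) y & enorm (t - y) <= delta / 2.
    by rewrite !inE/= => /andP[_ /asboolP].
  have cU : c < fine (sigma (crossing [set` U] (delta / 2))).
    (* Of the margin delta at the cell, half is spent on moving to the net points [U]; the other
       half is spent below on moving back. *)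
    apply: lt_le_trans (Hdelta _ aZ) _.
    apply: fine_sigma_le; [exact: measurable_crossing | exact: measurable_crossing |].
    apply: crossing_near => y Zy; have [t tF ty] := FS y (spherical_body_sub bZ Zy).
    exists t; last by rewrite enormB; lra.
    by rewrite /= !inE/= tF; apply/asboolP; exists y => //; exact: ltW.
  rewrite -bigcup_seq; exists (Some U).
    rewrite /= inE /=; apply/mapP; exists U => //; rewrite fpowersetE.
    by apply/fsubsetP => t; rewrite !inE/= => /andP[].
  (* A point of [X] crossing [U] with margin delta / 2 would cross the cell with margin 0, although
     the cell lies on one side of its hyperplane. *)
  rewrite /= cU => x Xx xU; apply: (cell_not_crossing Xx (pX x Xx)).
  apply: crossing_near (conj ((Xfin w).2 x Xx) xU) => t tU.
  by have [y Zy ty] := UP t tU; exists y => //; rewrite subr0.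
have mE := measurable_event neS HX.
apply: le_trans (le_measure _ _ _ sub) _; rewrite ?inE//.
  by apply: measurableU => //; exact: measurableC.
apply: le_trans (measureU2 _ _ _) _ => //; first exact: measurableC.
by rewrite [X in (X + _)%E]PH add0e; exact: probability_bigcup_avoiding_le.
Qed.

End LargeDeviations.

(** * From exponential bounds to the logarithmic limit *)

Lemma cvg_exponential_rate (R : realType) (q : R -> R) (tau : R) :
  (forall g, 0 < g -> expR (- (g * tau)) <= q g) ->
  (forall c, c < tau -> exists N : nat, forall g, 0 < g -> q g <= N%:R * expR (- (g * c))) ->
  g^-1 * ln (q g) @[g --> +oo] --> - tau.
Proof.
move=> qlow qup; apply/cvgrPdist_le => eps eps0.
(* Half of eps is given to the rate; the other half absorbs (ln N) / g for large g. *)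
have [|N HN] := qup (tau - eps / 2); first by rewrite gtrBl divr_gt0.
near=> g; have g0 : 0 < g by near: g; exact: nbhs_pinfty_gt.
have q0 : 0 < q g := lt_le_trans (expR_gt0 _) (qlow g g0).
have N0 : 0 < N%:R :> R.
  by have := lt_le_trans q0 (HN g g0); rewrite pmulr_lgt0 ?expR_gt0.
have low : - tau <= g^-1 * ln (q g).
  rewrite mulrC ler_pdivlMr// mulNr mulrC -[leLHS]expRK.
  by rewrite ler_ln ?posrE ?expR_gt0// qlow.
have up : g^-1 * ln (q g) <= - tau + eps.
  rewrite mulrC ler_pdivrMr//.
  have : ln (q g) <= ln (N%:R * expR (- (g * (tau - eps / 2)))).
    by rewrite ler_ln ?posrE ?mulr_gt0 ?expR_gt0// HN.
  move/le_trans; apply; rewrite lnM ?posrE ?expR_gt0// expRK.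
  have : ln N%:R <= g * (eps / 2).
    rewrite -ler_pdivrMr ?divr_gt0//; near: g; exact: nbhs_pinfty_ge.
  by move: (ln _) => l lg; lra.
by rewrite ler_norml; apply/andP; split; lra.
Unshelve. all: by end_near. Qed.

(** [tau] is defined as an infimum; the first conjunct makes it a minimum. Each intensity has its
    own probability space, and only g > 0 matters for the limit. *)
Theorem theoremC (R : realType) (d : nat) (hd : (2 <= d)%N)
    (p : 'rV[R]_d.+1) (hp : sphere R d.+1 p)
    (dT : R -> measure_display)
    (Omega : forall g : R, measurableType (dT g))
    (P : forall g : R, probability (Omega g) R)
    (X : forall g : R, Omega g -> set 'rV[R]_d.+1)
    (hX : forall g : R, 0 < g -> isotropic_poisson (P g) (@X g) g)
    (Sigma : set 'rV[R]_d.+1 -> R)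
    (hSigma : size_functional Sigma)
    (hext : extended_to_sphere Sigma)
    (hinc : increasing_functional Sigma)
    (hrot : rotation_invariant Sigma)
    (a : R) (ha : 0 < a) (hne : superlevel Sigma a !=set0) :
  (exists2 K, superlevel Sigma a K &
     hitting_functional K = tau (@hitting_functional R d.+1) Sigma a /\
     forall L, superlevel Sigma a L ->
       hitting_functional K <= hitting_functional L) /\
  g^-1 * ln (fine (P g [set w | a <= Sigma (crofton_cell p (@X g w))]))
    @[g --> +oo] --> - tau (@hitting_functional R d.+1) Sigma a.
Proof.
have [_ cSigma _ _] := hSigma; have n2 : (2 <= d.+1)%N := leqW hd.
have [K aK KE] := tau_attained cSigma hne.
split.
  by exists K => //; split=> // L aL; rewrite KE; exact: tau_lbound.
have Pfin g : 0 < g ->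
    P g [set w | a <= Sigma (crofton_cell p (@X g w))] \is a fin_num.
  move=> g0; apply: fin_num_measure.
  exact: (measurable_event n2 hp cSigma hext hne (hX g g0)).
apply: cvg_exponential_rate => [g g0|c ct].
  rewrite -KE -lee_fin fineK; last exact: Pfin.
  exact: (event_lower n2 hp cSigma hinc hext hrot g0 (hX g g0) aK).
have [N HN] := event_upper n2 hp cSigma hext hne ct.
exists N => g g0; rewrite -lee_fin fineK; last exact: Pfin.
exact: (HN _ _ (P g) (@X g) g g0 (hX g g0)).
Qed.
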